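(* Let $n\in\{1,\dots,N\}$, let $\mathbf X_h^{n-1}\in\mathbf V_h$ be given, and let $(\mathbf X_h^n,p_h^n,q_h^n)\in \mathbf V_h\times V_h\times V_h$ be a solution of the nonlinear system $$\int_I \frac{\mathbf X_h^n-\mathbf X_h^{n-1}}{\tau}\cdot(\phi_h\,\boldsymbol\nu_h^n)\,\mathrm d\xi=\int_I \partial_\xi p_h^n\,\partial_\xi\phi_h\,\rho_h^n\,\mathrm d\xi\qquad\forall\,\phi_h\in V_h,$$ $$\int_I \frac{\mathbf X_h^n-\mathbf X_h^{n-1}}{\tau}\cdot(\varphi_h\,\boldsymbol\tau_h^n)\,\mathrm d\xi=0\qquad\forall\,\varphi_h\in V_h,$$ $$\int_I (p_h^n\,\boldsymbol\nu_h^n+q_h^n\,\boldsymbol\tau_h^n)\cdot\boldsymbol\psi_h\,\mathrm d\xi=\sum_{j=1}^M\boldsymbol\psi_h(\xi_j)\cdot\int_{t_{n-1}}^{t_n}[\boldsymbol\tau_h]_j\,\mathrm dt\qquad\forall\,\boldsymbol\psi_h\in\mathbf V_h,$$ where $\boldsymbol\nu_h^n,\boldsymbol\tau_h^n,\rho_h^n$ and $[\boldsymbol\tau_h]_j$ are the quantities, depending on $\mathbf X_h^{n-1}$ and $\mathbf X_h^n$, defined in the context. Let $L(t_m)$ be the perimeter of the closed piecewise linear curve $\Gamma_h^m$ parametrized by $\mathbf X_h^m$, and let $A(t_m)$ be the area of the polygonal region enclosed by $\Gamma_h^m$, for $m=n-1,n$. Then: (1) $A(t_n)=A(t_{n-1})$;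 (2) $L(t_n)\le L(t_{n-1})$.
   Context: $I=[0,1]$ is the periodic unit interval ($0$ and $1$ are identified). $0=\xi_0<\xi_1<\cdots<\xi_M=1$ is a (quasi-uniform) partition of $I$, with $\xi_0$ and $\xi_M$ identified, and $I_j=[\xi_{j-1},\xi_j]$ for $j=1,\dots,M$. Let $P_1$ be the space of polynomials of degree $\le 1$, and $$V_h=\{\varphi\in C(I;\mathbb R):\varphi(0)=\varphi(1),\ \varphi|_{I_j}\in P_1,\ j=1,\dots,M\},$$ $$\mathbf V_h=\{\boldsymbol\psi\in C(I;\mathbb R^2):\boldsymbol\psi(0)=\boldsymbol\psi(1),\ \boldsymbol\psi|_{I_j}\in P_1\times P_1,\ j=1,\dots,M\}.$$ Time is discretized by $t_n=n\tau$, $n=0,1,\dots,N$, with $\tau=T/N$, $T>0$. (The scalar $\tau$ is the time step; bold $\boldsymbol\tau$ symbols denote tangent vectors.) For each $m$, $\mathbf X_h^m\in\mathbf V_h$ parametrizes a closed piecewise linear curve $\Gamma_h^m=\{\mathbf X_h^m(\xi):\xi\in I\}$ with non-coincident nodes $\mathbf x_j^m=\mathbf X_h^m(\xi_j)\in\mathbb R^2$, $j=1,\dots,M$ (and $\mathbf x_0^m=\mathbf x_M^m$). The curve is a simple closed polygon and its nodes are listed in counter-clockwise order, so it encloses a polygonal region whose area is $A(t_m)$. The perimeter is $L(t_m)=\int_I|\partial_\xi\mathbf X_h^m|\,\mathrm d\xi$. For $t\in[t_{n-1},t_n]$ define the intermediate parametrization $$\mathbf X_h(\xi,t)=\frac{t_n-t}{\tau}\mathbf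 X_h^{n-1}(\xi)+\frac{t-t_{n-1}}{\tau}\mathbf X_h^n(\xi).$$ It is understood that $\partial_\xi\mathbf X_h(\xi,t)\neq 0$ on each subinterval $I_j$ for all $t\in[t_{n-1},t_n]$, so that the following quantities are well defined. For a vector $\mathbf a\in\mathbb R^2$, $\mathbf a^\perp$ denotes its rotation by the angle $\pi/2$ in the counter-clockwise direction. Define $$\boldsymbol\tau_h(\xi,t)=\frac{\partial_\xi\mathbf X_h(\xi,t)}{|\partial_\xi\mathbf X_h(\xi,t)|},$$ which is piecewise constant in $\xi$, and its jump at the node $\xi_j$ (using periodicity at $\xi_M=\xi_0$), $$[\boldsymbol\tau_h]_j=\lim_{\varepsilon\to0^+}\big(\boldsymbol\tau_h(\xi_j+\varepsilon,t)-\boldsymbol\tau_h(\xi_j-\varepsilon,t)\big).$$ Finally, define $$\boldsymbol\nu_h^n(\xi)=\int_{t_{n-1}}^{t_n}(\partial_\xi\mathbf X_h(\xi,t))^\perp\,\mathrm dt,\qquad \boldsymbol\tau_h^n(\xi)=\int_{t_{n-1}}^{t_n}\partial_\xi\mathbf X_h(\xi,t)\,\mathrm dt,\qquad \rho_h^n(\xi)=\int_{t_{n-1}}^{t_n}|\partial_\xi\mathbf X_h(\xi,t)|^{-1}\,\mathrm dt.$$ *)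

(* Defs.v *)
From mathcomp Require Export all_boot all_order all_algebra.
From mathcomp Require Export all_classical all_reals all_analysis.
Export Order.TTheory GRing.Theory Num.Theory numFieldNormedType.Exports.

Set Implicit Arguments.
Unset Strict Implicit.
Unset Printing Implicit Defensive.

Local Open Scope classical_set_scope.
Local Open Scope ring_scope.

(* The library norm on the product R * R is the max norm, hence an explicit
   Euclidean structure. *)
Definition dot (R : realType) (a b : R * R) : R := a.1 * b.1 + a.2 * b.2.

Definition enorm (R : realType) (a : R * R) : R := Num.sqrt (dot a a).

Definition perp (R : realType) (a : R * R) : R * R := (- a.2, a.1).

Definition integral (R : realType) (a b : R) (f : R -> R) : R :=
  \int[lebesgue_measure]_(x in `[a, b]) f x.

Definition vintegral (R : realType) (a b : R) (f : R -> R * R) : R * R :=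
  (integral a b (fun x => (f x).1), integral a b (fun x => (f x).2)).

(* Only the values xi 0, ..., xi M are relevant.  Quasi-uniformity constrains
   families of partitions and is void for a single one. *)
Definition partition01 (R : realType) (M : nat) (xi : nat -> R) : Prop :=
  [/\ xi 0%N = 0, xi M = 1 & forall j, (j < M)%N -> xi j < xi j.+1].

Definition P1_on (R : realType) (a b : R) (f : R -> R) : Prop :=
  exists2 p : {poly R}, (size p <= 2)%N & forall x, a <= x <= b -> f x = p.[x].

(* Functions on I = [0, 1] are represented by functions on R whose values
   outside [0, 1] are irrelevant. *)
Definition Vh (R : realType) (M : nat) (xi : nat -> R) (f : R -> R) : Prop :=
  [/\ {within `[0, 1], continuous f}, f 0 = f 1
    & forall j, (j < M)%N -> P1_on (xi j) (xi j.+1) f].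

Definition vVh (R : realType) (M : nat) (xi : nat -> R) (f : R -> R * R) :
    Prop :=
  [/\ {within `[0, 1], continuous f}, f 0 = f 1
    & forall j, (j < M)%N -> P1_on (xi j) (xi j.+1) (fun x => (f x).1) /\
                             P1_on (xi j) (xi j.+1) (fun x => (f x).2)].

Definition curve (R : realType) (X : R -> R * R) : set (R * R) :=
  X @` `[0, 1].

Definition simple_closed (R : realType) (X : R -> R * R) : Prop :=
  X 0 = X 1 /\
  forall x y, 0 <= x < 1 -> 0 <= y < 1 -> X x = X y -> x = y.

(* The points off the curve that lie in a bounded connected component of its
   complement. *)
Definition enclosed (R : realType) (X : R -> R * R) : set (R * R) :=
  [set p | ~ curve X p /\ bounded_set (connected_component (~` curve X) p)].

(* Counter-clockwise orientation: the enclosed region lies locally to the left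
   of every edge traversed in the order of the nodes. *)
Definition counterclockwise (R : realType) (M : nat) (xi : nat -> R)
    (X : R -> R * R) : Prop :=
  forall j x, (j < M)%N -> xi j < x < xi j.+1 ->
    \forall s \near 0^'+, enclosed X (X x + s *: perp (X (xi j.+1) - X (xi j))).

Definition area (R : realType) (X : R -> R * R) : \bar R :=
  (lebesgue_measure \x lebesgue_measure)%E (enclosed X).

Definition perimeter (R : realType) (X : R -> R * R) : R :=
  integral 0 1 (fun x => enorm (derive1 X x)).

Definition tnode (R : realType) (tau : R) (n : nat) : R := n%:R * tau.

(* Below, X0 and X1 are the parametrizations at the times t_{n-1} and t_n. *)
Definition Xh (R : realType) (tau : R) (n : nat) (X0 X1 : R -> R * R)
    (t x : R) : R * R :=
  ((tnode tau n - t) / tau) *: X0 x + ((t - tnode tau n.-1) / tau) *: X1 x.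

(* At the nodes xi_j, where the derivative need not exist, the value is
   irrelevant. *)
Definition dXh (R : realType) (tau : R) (n : nat) (X0 X1 : R -> R * R)
    (t x : R) : R * R :=
  derive1 (Xh tau n X0 X1 t) x.

Definition tauh (R : realType) (tau : R) (n : nat) (X0 X1 : R -> R * R)
    (t x : R) : R * R :=
  (enorm (dXh tau n X0 X1 t x))^-1 *: dXh tau n X0 X1 t x.

(* The fractional part implements the identification of 0 and 1 in I. *)
Definition frac (R : realType) (x : R) : R := x - (Num.floor x)%:~R.

Definition jump (R : realType) (f : R -> R * R) (x : R) : R * R :=
  lim ((f (frac (x + e)) - f (frac (x - e))) @[e --> 0^'+]).

Definition nuhn (R : realType) (tau : R) (n : nat) (X0 X1 : R -> R * R)
    (x : R) : R * R :=
  vintegral (tnode tau n.-1) (tnode tau n)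
    (fun t => perp (dXh tau n X0 X1 t x)).

Definition tauhn (R : realType) (tau : R) (n : nat) (X0 X1 : R -> R * R)
    (x : R) : R * R :=
  vintegral (tnode tau n.-1) (tnode tau n) (fun t => dXh tau n X0 X1 t x).

Definition rhohn (R : realType) (tau : R) (n : nat) (X0 X1 : R -> R * R)
    (x : R) : R :=
  integral (tnode tau n.-1) (tnode tau n)
    (fun t => (enorm (dXh tau n X0 X1 t x))^-1).

Definition scheme_solution (R : realType) (M : nat) (xi : nat -> R) (tau : R)
    (n : nat) (X0 X1 : R -> R * R) (p q : R -> R) : Prop :=
  [/\ forall phi, Vh M xi phi ->
        integral 0 1 (fun x =>
          dot (tau^-1 *: (X1 x - X0 x)) (phi x *: nuhn tau n X0 X1 x)) =
        integral 0 1 (fun x =>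
          derive1 p x * derive1 phi x * rhohn tau n X0 X1 x),
      forall phi, Vh M xi phi ->
        integral 0 1 (fun x =>
          dot (tau^-1 *: (X1 x - X0 x)) (phi x *: tauhn tau n X0 X1 x)) = 0
    & forall psi, vVh M xi psi ->
        integral 0 1 (fun x =>
          dot (p x *: nuhn tau n X0 X1 x + q x *: tauhn tau n X0 X1 x)
              (psi x)) =
        \sum_(1 <= j < M.+1)
          dot (psi (xi j))
              (vintegral (tnode tau n.-1) (tnode tau n)
                 (fun t => jump (tauh tau n X0 X1 t) (xi j)))].

(* Main.v *)
From mathcomp Require Import measurable_realfun ring lra.
Require Import Defs.

Set Implicit Arguments.
Unset Strict Implicit.
Unset Printing Implicit Defensive.

(** The scheme is tested with three choices.  Let [W = X1 - X0].

    Area.  Tested with the constant 1, the first equation has right-hand side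
    zero, so the sum over the edges of the cross product of the mean of [W] on
    the edge with the time average of the edge vector vanishes.  A summation by
    parts shows that this sum is the difference of the two shoelace sums
    ([shoelace_conserved]).  It remains to know that the area of the enclosed
    region, which is defined by bounded components of the complement, is the
    shoelace sum ([area_shoelace]).

    Perimeter.  Testing the third equation with [W], and the first two with
    [p] and [q], gives that the sum over the nodes of [W] times the time
    integral of the jump of the tangent is a nonnegative multiple of the
    integral of [p'^2 rho].  By summation by parts over the nodes the sum of
    jumps is minus the sum over the edges of the increment of [W] times the
    time integral of the unit tangent; the latter product is, up to the
    factor [tau], the increment of the edge length, because the derivative of
    the norm of a moving vector is its velocity times its direction
    ([length_derivative], [perimeter_decreases]).

    Shoelace formula.  Membership in the enclosed region is locally constant
    off the curve.  Near an interior point of an edge the curve is only that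
    edge, so each side of the edge near that point is either wholly enclosed
    or wholly not enclosed; the left side is enclosed by the orientation
    hypothesis.  The right side has the same status along one edge, and also
    across a vertex, since locally the right-hand sides of two consecutive
    edges lie in one connected sector ([vertex_sector]).  Just above the
    highest crossing of a generic vertical line with the curve one is not
    enclosed, so some right side, hence every right side, is not enclosed
    ([exists_right_exterior], [right_exterior_all]).  Thus on a generic
    vertical line the indicator of the region jumps by [+1] or [-1] at each
    crossing, according to the sign of the horizontal component of the edge
    ([enclosed_slice]).  Integrating the slices gives the formula. *)

Local Open Scope classical_set_scope.
Local Open Scope ring_scope.

(** * The plane *)

Definition cross (R : realType) (a b : R * R) : R := a.1 * b.2 - a.2 * b.1.

Lemma coordE (R : realType) :
  (forall a b : R * R, ((a + b).1 = a.1 + b.1) * ((a + b).2 = a.2 + b.2)) *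
  (forall a : R * R, ((- a).1 = - a.1) * ((- a).2 = - a.2)) *
  (forall (t : R) (a : R * R), ((t *: a).1 = t * a.1) * ((t *: a).2 = t * a.2)).
Proof. by []. Qed.

Section plane.
Variable R : realType.
Implicit Types (p q P v d : R * R) (X : R -> R * R).

Lemma near_line P v (Q : set (R * R)) : (\forall p \near P, Q p) ->
  \forall s \near (0 : R), Q (P + s *: v).
Proof.
have : (P + s *: v) @[s --> (0 : R)] --> P.
  rewrite -[X in _ --> X]addr0 -(scale0r v).
  apply: cvgD; first exact: cvg_cst.
  exact: cvgZr_tmp.
exact.
Qed.

Lemma near_box P (Q : set (R * R)) : (\forall p \near P, Q p) ->
  exists2 e : R, 0 < e &
    forall p, `|p.1 - P.1| < e -> `|p.2 - P.2| < e -> Q p.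
Proof.
move=> /nbhs_ballP[e e0 he]; exists e => // p h1 h2; apply: he.
by split => /=; rewrite /ball /= distrC.
Qed.

Lemma box_near P (e : R) : 0 < e ->
  \forall p \near P, `|p.1 - P.1| < e /\ `|p.2 - P.2| < e.
Proof.
move=> e0; apply/nbhs_ballP; exists e => //= p [/= h1 h2].
by rewrite distrC (distrC p.2).
Qed.

Lemma segment_connected p q :
  connected [set p + t *: (q - p) | t in `[(0 : R), 1]].
Proof.
apply: connected_continuous_connected; first exact: segment_connected.
apply: continuous_subspaceT => t.
apply: cvgD; first exact: cvg_cst.
exact: cvgZr_tmp.
Qed.

(** A segment off the curve stays in one component of the complement. *)
Lemma enclosed_segment X p q :
  (forall t, 0 <= t <= 1 -> ~ curve X (p + t *: (q - p))) ->
  enclosed X p -> enclosed X q.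
Proof.
move=> h [cp bp].
have cq : ~ curve X q.
  by have := h 1; rewrite ler01 lexx scale1r addrC subrK; exact.
split=> //; rewrite -(@same_connected_component _ _ p q) //.
pose S := [set p + t *: (q - p) | t in `[(0 : R), 1]].
apply: (@connected_component_max _ (~` curve X) S) => //.
- by exists 0; [rewrite /= in_itv /= lexx ler01|rewrite scale0r addr0].
- by move=> _ [t + <-]; rewrite /= in_itv /= => /h.
- exact: segment_connected.
- by exists 1; [rewrite /= in_itv /= ler01 lexx|rewrite scale1r addrC subrK].
Qed.

Definition convex_in_plane (A : set (R * R)) := forall p q (t : R),
  A p -> A q -> 0 <= t <= 1 -> A (p + t *: (q - p)).

Lemma convexI A B : convex_in_plane A -> convex_in_plane B ->
  convex_in_plane (A `&` B).
Proof.
by move=> cA cB p q t [Ap Bp] [Aq Bq] t01; split; [apply: cA|apply: cB].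
Qed.

Lemma convex_halfplane d P : convex_in_plane [set p | cross d (p - P) < 0].
Proof.
move=> p q t; rewrite /cross /= => h1 h2 /andP[t0 t1].
set a := _ - _ in h1; set b := _ - _ in h2.
have -> : d.1 * ((p + t *: (q - p)).2 - P.2) -
    d.2 * ((p + t *: (q - p)).1 - P.1) = (1 - t) * a + t * b.
  by rewrite /a /b !coordE; ring.
by nra.
Qed.

Lemma convex_box P (e : R) :
  convex_in_plane [set p | `|p.1 - P.1| < e /\ `|p.2 - P.2| < e].
Proof.
have aux (a b c t : R) : `|a - c| < e -> `|b - c| < e -> 0 <= t <= 1 ->
    `|a + t * (b - a) - c| < e.
  rewrite !ltr_norml; set x := a - c; set y := b - c.
  have -> : a + t * (b - a) - c = (1 - t) * x + t * y by rewrite /x /y; ring.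
  move: x y => x y /andP[x1 x2] /andP[y1 y2] /andP[t0].
  rewrite le_eqVlt => /orP[/eqP ->|t1]; apply/andP; split; nra.
by move=> p q t [p1 p2] [q1 q2] t01; split; rewrite !coordE; apply: aux.
Qed.

Lemma enclosed_convex X (A : set (R * R)) : convex_in_plane A ->
  (forall p, A p -> ~ curve X p) ->
  forall p q, A p -> A q -> enclosed X p -> enclosed X q.
Proof. by move=> cA h p q Ap Aq; apply: enclosed_segment => t t01; apply/h/cA. Qed.

Lemma unbounded_ray (B : set (R * R)) p v : v != 0 ->
  (forall t : R, 0 <= t -> B (p + t *: v)) -> ~ bounded_set B.
Proof.
move=> v0 h [M0 [_ hM]]; have /= M1 := hM (`|M0| + 1).
have {}M1 : forall x, B x -> `|x| <= `|M0| + 1.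
  by apply: M1; rewrite (le_lt_trans (ler_norm _)) // ltrDl.
have nv : 0 < `|v| by rewrite normr_gt0.
(* far enough along the ray for the norm to exceed [`|M0| + 1] *)
pose t := (`|M0| + 2 + `|p|) / `|v|.
have t0 : 0 <= t by rewrite divr_ge0 // !addr_ge0.
have := M1 _ (h t t0); apply/negP; rewrite -ltNge.
have : `|t *: v| <= `|p + t *: v| + `|p|.
  by rewrite -[in X in X <= _](addrK p (t *: v)) (addrC (t *: v)) ler_normB.
rewrite normrZ (ger0_norm t0) /t divfK ?gt_eqF //.
lra.
Qed.

End plane.

(** * Locally constant functions *)

Lemma near_between (R : realType) (a b x : R) : a < x < b ->
  \forall y \near x, a < y < b.
Proof.
move=> axb; have xin : x \in `]a, b[ by rewrite in_itv.
by near do rewrite -[_ && _]/(_ \in `]a, b[); apply: near_in_itvoo.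
Unshelve. all: by end_near. Qed.

(** The level set of [f x] and its complement in the interval are both open,
    and intervals are connected. *)
Lemma locally_constant_itv (R : realType) (T : Type) (f : R -> T) (a b : R) :
  (forall x, a < x < b -> \forall y \near x, f y = f x) ->
  forall x y, a < x < b -> a < y < b -> f x = f y.
Proof.
move=> lc x y axb ayb.
have opn (Q : T -> Prop) : open [set z | a < z < b /\ Q (f z)].
  rewrite openE => z /= [azb Qz].
  have ha := near_between azb; have hb := lc z azb.
  by near=> w; split; [near: w|rewrite (near hb w)].
have /connected_intervalP con : is_interval (`]a, b[%classic : set R).
  exact/interval_is_interval.
have E : [set z | a < z < b /\ f z = f x] = `]a, b[%classic.
  apply: con.
  - by exists x.
  - exists [set z | a < z < b /\ f z = f x].
      exact: (opn (fun w => w = f x)).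
    by apply/seteqP; split => z /=; rewrite in_itv /=; [case=> -> ->|case=> _].
  - exists (~` [set z | a < z < b /\ f z <> f x]).
      exact/open_closedC/(opn (fun w => w <> f x)).
    apply/seteqP; split => z /=; rewrite in_itv /=.
      by case=> -> ->; split => // -[].
    by case=> -> h; split=> //; apply: contrapT => h1; apply: h.
have : `]a, b[%classic y by rewrite /= in_itv.
by rewrite -E => -[].
Unshelve. all: by end_near. Qed.

(** * Partitions and piecewise affine curves *)

Section partition.
Variables (R : realType) (M : nat) (xi : nat -> R).
Hypothesis hxi : partition01 M xi.

Lemma partition_lt i j : (i < j <= M)%N -> xi i < xi j.
Proof.
case: hxi => _ _ h; elim: j => // j IH /andP[]; rewrite ltnS leq_eqVlt.
move=> /predU1P[-> /h//|ij jM].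
by apply: lt_trans (h _ jM); apply: IH; rewrite ij ltnW.
Qed.

Lemma partition_le i j : (i <= j <= M)%N -> xi i <= xi j.
Proof.
rewrite leq_eqVlt => /andP[/predU1P[->//|ij] jM].
by apply/ltW/partition_lt; rewrite ij.
Qed.

Lemma partition_ge0 j : (j <= M)%N -> 0 <= xi j.
Proof. by case: hxi => <- _ _ jM; rewrite partition_le. Qed.

Lemma partition_le1 j : (j <= M)%N -> xi j <= 1.
Proof. by case: hxi => _ <- _ jM; rewrite partition_le ?jM ?leqnn. Qed.

Lemma partition_size_gt0 : (0 < M)%N.
Proof.
by case: hxi => h0 h1 _; rewrite lt0n; apply/eqP => M0; move: h1 (@ltr01 R);
  rewrite M0 h0 => ->; rewrite ltxx.
Qed.

Lemma partition_mesh j : (j < M)%N -> 0 < xi j.+1 - xi j.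
Proof. by case: hxi => _ _ h jM; rewrite subr_gt0 h. Qed.

Lemma partition_locate x : 0 <= x < 1 ->
  exists2 j, (j < M)%N & xi j <= x < xi j.+1.
Proof.
case: hxi => h0 h1 _ /andP[x0 x1].
have : exists j, (j <= M)%N && (x < xi j) by exists M; rewrite leqnn h1.
move=> /ex_minnP[[|j]]; first by rewrite h0 ltNge x0.
move=> /andP[jM xj] hmin; exists j => //; rewrite xj andbT leNgt.
by apply/negP => xj'; have := hmin j; rewrite xj' ltnW // ltnn => /(_ isT).
Qed.

End partition.

Lemma P1_on_affine (R : realType) (a b : R) (f : R -> R) x : a < b ->
  P1_on a b f -> a <= x <= b -> f x = f a + (x - a) / (b - a) * (f b - f a).
Proof.
move=> ab [p sp hp] axb.
have ba : b - a != 0 by rewrite subr_eq0 gt_eqF.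
have ev (z : R) : p.[z] = p`_0 + p`_1 * z.
  rewrite (horner_coef_wide z sp) big_ord_recl big_ord1 /= expr0 mulr1.
  by rewrite expr1.
rewrite !hp ?lexx ?(ltW ab) // !ev; field.
exact: ba.
Qed.

Section polygon.
Variables (R : realType) (M : nat) (xi : nat -> R) (X : R -> R * R).
Hypothesis hxi : partition01 M xi.
Hypothesis hX : vVh M xi X.

Local Notation V j := (X (xi j)).
Local Notation d j := (X (xi j.+1) - X (xi j)).

Definition edge_param j (u : R) := xi j + u * (xi j.+1 - xi j).

Lemma edge_param_in j u : (j < M)%N -> 0 < u < 1 ->
  xi j < edge_param j u < xi j.+1.
Proof.
move=> jM; have := partition_mesh hxi jM; rewrite /edge_param.
by move=> ? /andP[? ?]; apply/andP; split; nra.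
Qed.

Lemma edge_param_in01 j u : (j < M)%N -> 0 < u < 1 -> 0 < edge_param j u < 1.
Proof.
move=> jM /(edge_param_in jM)/andP[h1 h2].
by rewrite (le_lt_trans (partition_ge0 hxi (ltnW jM)) h1)
  (lt_le_trans h2) // (partition_le1 hxi).
Qed.

Lemma edge_affine j x : (j < M)%N -> xi j <= x <= xi j.+1 ->
  X x = V j + ((x - xi j) / (xi j.+1 - xi j)) *: d j.
Proof.
move=> jM h; case: hX => _ _ /(_ j jM)[h1 h2].
have lt := partition_mesh hxi jM; rewrite subr_gt0 in lt.
rewrite (surjective_pairing (X x)) (P1_on_affine lt h1 h).
by rewrite (P1_on_affine lt h2 h).
Qed.

Lemma edge_paramE j u : (j < M)%N -> 0 <= u <= 1 ->
  X (edge_param j u) = V j + u *: d j.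
Proof.
move=> jM /andP[u0 u1]; have lt := partition_mesh hxi jM.
rewrite (edge_affine jM).
  have -> : edge_param j u - xi j = u * (xi j.+1 - xi j).
    by rewrite /edge_param; ring.
  by rewrite mulfK // gt_eqF.
by apply/andP; split; rewrite /edge_param; nra.
Qed.

Lemma edge_param_surj j x : (j < M)%N -> xi j < x < xi j.+1 ->
  exists2 u, 0 < u < 1 & x = edge_param j u.
Proof.
move=> jM /andP[h1 h2]; have lt := partition_mesh hxi jM.
exists ((x - xi j) / (xi j.+1 - xi j)).
  by rewrite ltr_pdivlMr // ltr_pdivrMr // mul0r mul1r subr_gt0 ltrD2r h1.
by rewrite /edge_param divfK ?gt_eqF // addrC subrK.
Qed.

Hypothesis hsimple : simple_closed X.

Lemma simple_inj x y : 0 <= x < 1 -> 0 <= y < 1 -> X x = X y -> x = y.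
Proof. by case: hsimple => _; apply. Qed.

(** On an edge with equal end points the curve would be constant. *)
Lemma edge_neq0 j : (j < M)%N -> d j != 0.
Proof.
move=> jM; apply/eqP => d0.
have h12 : 0 < (1/2 : R) < 1 by lra.
have h14 : 0 < (1/4 : R) < 1 by lra.
have cst u : 0 < u < 1 -> X (edge_param j u) = V j.
  by move=> /andP[/ltW u0 /ltW u1]; rewrite edge_paramE ?u0 // d0 scaler0 addr0.
have : edge_param j (1/2) = edge_param j (1/4).
  apply: simple_inj.
  - by have /andP[/ltW -> ->] := edge_param_in01 jM h12.
  - by have /andP[/ltW -> ->] := edge_param_in01 jM h14.
  - by rewrite !cst.
have := partition_mesh hxi jM; rewrite /edge_param; lra.
Qed.

(** The part of the curve outside the parameter window is compact, and by
    simplicity it misses [X x]. *)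
Lemma curve_near_arc a x b : 0 <= a -> a < x < b -> b <= 1 ->
  \forall p \near X x, forall y, 0 <= y <= 1 -> X y = p -> a < y < b.
Proof.
move=> a0 /andP[ax xb] b1.
have [cX _ _] := hX; have [X01 _] := hsimple.
have sub (u v : R) : 0 <= u -> v <= 1 -> closed (X @` `[u, v]).
  move=> u0 v1; apply: compact_closed.
    exact: norm_hausdorff.
  apply: continuous_compact; last exact: segment_compact.
  apply: continuous_subspaceW cX => z /=; rewrite !in_itv /= => /andP[h1 h2].
  by rewrite (le_trans u0 h1) (le_trans h2 v1).
have x0 : 0 < x by exact: le_lt_trans ax.
have x1 : x < 1 by exact: lt_le_trans b1.
have cl : closed (X @` `[0, a] `|` X @` `[b, 1]).
  by apply: closedU; apply: sub => //; lra.
have : \forall p \near X x, (~` (X @` `[0, a] `|` X @` `[b, 1])) p.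
  apply: open_nbhs_nbhs; split; first exact: closed_openC.
  case=> [] [y] /=; rewrite in_itv /= => /andP[y0 y1] Xy.
    have := simple_inj (x := y) (y := x); rewrite y0 (le_lt_trans y1 (lt_trans ax x1)).
    rewrite (ltW x0) x1 => /(_ isT isT Xy) yx; move: ax; rewrite -yx ltNge.
    by rewrite y1.
  move: y1; rewrite le_eqVlt => /predU1P[y1|y1].
    have := simple_inj (x := 0) (y := x); rewrite lexx ltr01 (ltW x0) x1.
    by rewrite X01 -y1 => /(_ isT isT Xy) x0'; rewrite -x0' ltxx in x0.
  have := simple_inj (x := y) (y := x); rewrite y1 (ltW x0) x1 andbT.
  rewrite (le_trans _ y0) ?(ltW (lt_trans x0 xb)) // => /(_ isT isT Xy) yx.
  by rewrite -yx ltNge y0 in xb.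
apply: filterS => p np y /andP[y0 y1] Xy; apply/andP.
by split; rewrite ltNge; apply/negP => h; apply: np; [left|right];
  exists y => //=; rewrite in_itv /=; apply/andP.
Qed.

Lemma closed_curve : closed (curve X).
Proof.
apply: compact_closed; first exact: norm_hausdorff.
apply: continuous_compact; last exact: segment_compact.
by case: hX.
Qed.

Lemma enclosed_near p : ~ curve X p ->
  \forall q \near p, enclosed X q = enclosed X p.
Proof.
move=> cp; have /near_box[e e0 he] : \forall q \near p, ~ curve X q.
  by apply: open_nbhs_nbhs; split=> //; exact/closed_openC/closed_curve.
apply: filterS (box_near p e0) => q hq; apply/propext.
have pp : `|p.1 - p.1| < e /\ `|p.2 - p.2| < e by rewrite !subrr normr0.
by split; apply: (enclosed_convex (@convex_box _ p e)) => // r [h1 h2];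
  apply: he.
Qed.

(** The open half-plane and a small box around [P] meet in a convex set that is
    disjoint from the curve. *)
Lemma halfplane_status (w Q P : R * R) :
  (\forall p \near P, curve X p -> ~ (cross w (p - Q) < 0)) ->
  (\forall p \near P, cross w (p - Q) < 0 -> enclosed X p) \/
  (\forall p \near P, cross w (p - Q) < 0 -> ~ enclosed X p).
Proof.
move=> /near_box[e e0 he].
pose A := [set p : R * R | cross w (p - Q) < 0] `&`
  [set p | `|p.1 - P.1| < e /\ `|p.2 - P.2| < e].
have cA : convex_in_plane A.
  by apply: convexI; [exact: convex_halfplane|exact: convex_box].
have offA p : A p -> ~ curve X p by move=> [h [h1 h2]] cp; exact: (he p).
have [[p0 [Ap0 Ep0]]|no] := pselect (exists p, A p /\ enclosed X p).
  left; apply: filterS (box_near P e0) => p hp hc.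
  by apply: (enclosed_convex cA offA Ap0).
right; apply: filterS (box_near P e0) => p hp hc Ep.
by apply: no; exists p.
Qed.

Lemma cross_self_perp (w : R * R) : w != 0 -> 0 < cross w (perp w).
Proof.
move=> w0; rewrite /cross /perp /=.
have : w.1 != 0 \/ w.2 != 0.
  apply/orP; rewrite -negb_and; apply: contra w0 => /andP[/eqP a /eqP b].
  by rewrite (surjective_pairing w) a b.
case=> /eqP h.
  have : 0 < w.1 * w.1 by rewrite -expr2 exprn_even_gt0 //; apply/eqP.
  have := sqr_ge0 w.2; lra.
have : 0 < w.2 * w.2 by rewrite -expr2 exprn_even_gt0 //; apply/eqP.
have := sqr_ge0 w.1; lra.
Qed.

(** Small displacements along [- perp w] enter the open half-plane.  This
    serves to show that the two alternatives of [halfplane_status] exclude each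
    other. *)
Lemma halfplane_near_nonempty (w Q P : R * R) (A : set (R * R)) : w != 0 ->
  cross w (P - Q) <= 0 -> (\forall p \near P, A p) ->
  exists2 p, cross w (p - Q) < 0 & A p.
Proof.
move=> w0 PQ /(near_line (- perp w)) h.
have : \forall s \near (0 : R)^'+, A (P + s *: - perp w).
  exact: cvg_within h.
move=> hA; have h0 := nbhs_right_gt (0 : R).
have [s [As s0]] := filter_ex (filterI hA h0).
exists (P + s *: - perp w) => //.
have := cross_self_perp w0; rewrite /cross !coordE => hw.
have : 0 < s * (w.1 * (perp w).2 - w.2 * (perp w).1) by rewrite mulr_gt0.
by move: PQ; rewrite /cross !coordE; lra.
Qed.

End polygon.

(** * The two sides of an edge *)

Section sides.
Variables (R : realType) (M : nat) (xi : nat -> R) (X : R -> R * R).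
Hypothesis hxi : partition01 M xi.
Hypothesis hX : vVh M xi X.
Hypothesis hsimple : simple_closed X.

Local Notation V j := (X (xi j)).
Local Notation d j := (X (xi j.+1) - X (xi j)).

Lemma edge_collinear j x : (j < M)%N -> xi j <= x <= xi j.+1 ->
  cross (d j) (X x - V j) = 0.
Proof.
by move=> jM /(edge_affine hxi hX jM) ->; rewrite /cross !coordE; ring.
Qed.

Lemma curve_near_edge j x : (j < M)%N -> xi j < x < xi j.+1 ->
  \forall p \near X x, curve X p -> cross (d j) (p - V j) = 0.
Proof.
move=> jM xj; have := curve_near_arc hX hsimple (partition_ge0 hxi (ltnW jM))
  xj (partition_le1 hxi jM).
apply: filterS => p hp [y]; rewrite /= in_itv /= => y01 yp.
have /andP[h1 h2] := hp y y01 yp.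
by rewrite -yp edge_collinear // (ltW h1) (ltW h2).
Qed.

Lemma near_cross (w Q P : R * R) : cross w (P - Q) < 0 ->
  \forall p \near P, cross w (p - Q) < 0.
Proof.
move=> h.
have c : cross w (p - Q) @[p --> P] --> cross w (P - Q).
  have c1 : p.1 @[p --> P] --> P.1 by exact: cvg_fst.
  have c2 : p.2 @[p --> P] --> P.2 by exact: cvg_snd.
  by apply: cvgB; (apply: cvgM; first exact: cvg_cst);
    apply: cvgB => //; exact: cvg_cst.
exact: cvgr_lt c _ h.
Qed.

Lemma crossN (w v : R * R) : cross (- w) v = - cross w v.
Proof. by rewrite /cross !coordE; ring. Qed.

Definition right_exterior j x := \forall p \near X x,
  cross (d j) (p - V j) < 0 -> ~ enclosed X p.

Lemma right_status j x : (j < M)%N -> xi j < x < xi j.+1 ->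
  (\forall p \near X x, cross (d j) (p - V j) < 0 -> enclosed X p) \/
  right_exterior j x.
Proof.
move=> jM xj; apply: halfplane_status.
by have := curve_near_edge jM xj; apply: filterS => p h /h ->; rewrite ltxx.
Qed.

Lemma right_status_excl j x : (j < M)%N -> xi j < x < xi j.+1 ->
  (\forall p \near X x, cross (d j) (p - V j) < 0 -> enclosed X p) ->
  right_exterior j x -> False.
Proof.
move=> jM xj h1 h2.
have [||p pc [/(_ pc) E /(_ pc)]] := halfplane_near_nonempty (w := d j)
  (Q := V j) _ _ (filterI h1 h2).
- exact: edge_neq0 hX hsimple _ jM.
- by rewrite edge_collinear //; move: xj => /andP[/ltW -> /ltW ->].
- exact.
Qed.

Lemma continuous_edge j x : (j < M)%N -> xi j < x < xi j.+1 ->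
  {for x, continuous X}.
Proof.
move=> jM xj.
pose Y y := V j + ((y - xi j) / (xi j.+1 - xi j)) *: d j.
have XY : \forall y \near x, Y y = X y.
  apply: filterS (near_between xj) => y /andP[/ltW h1 /ltW h2].
  by rewrite (edge_affine hxi hX jM) // h1.
have cY : Y y @[y --> x] --> Y x.
  apply: cvgD; first exact: cvg_cst.
  apply: cvgZr_tmp; apply: cvgM; last exact: cvg_cst.
  by apply: cvgB => //; exact: cvg_cst.
have xE : Y x = X x by exact: nbhs_singleton XY.
have : X y @[y --> x] --> Y x by exact: cvg_trans (near_eq_cvg XY) cY.
by rewrite xE.
Qed.

(** The alternative of [right_status] at a point holds on a whole
    neighbourhood of it, hence at the nearby points of the edge: the status is
    locally constant along the open edge. *)
Lemma right_exterior_edge j x y : (j < M)%N ->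
  xi j < x < xi j.+1 -> xi j < y < xi j.+1 ->
  right_exterior j x -> right_exterior j y.
Proof.
move=> jM xj yj rx.
suff <- : right_exterior j x = right_exterior j y by [].
apply: (@locally_constant_itv _ _ (right_exterior j) _ _ _ _ _ xj yj).
move=> z zj; have cz := continuous_edge jM zj; have zb := near_between zj.
have [h|h] := right_status jM zj.
  have /cz h' := nbhs_interior h.
  near=> w; have wj : xi j < w < xi j.+1 by near: w.
  apply/propext; split => r; exfalso.
    by apply: (@right_status_excl j w) => //; near: w.
  exact: (@right_status_excl j z).
have /cz h' := nbhs_interior h.
by near=> w; apply/propext; split => // _; near: w.
Unshelve. all: by end_near. Qed.

Lemma collinear_scale (a b : R * R) : a != 0 -> cross a b = 0 ->
  b = (dot a b / dot a a) *: a.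
Proof.
move=> a0 c0; have n0 : dot a a != 0.
  by have := cross_self_perp a0; rewrite /cross /perp /dot /=; lra.
have h1 : a.1 * cross a b = 0 by rewrite c0 mulr0.
have h2 : a.2 * cross a b = 0 by rewrite c0 mulr0.
rewrite [LHS]surjective_pairing [RHS]surjective_pairing !coordE.
congr (_, _); apply: (mulfI n0); rewrite mulrA (mulrC (dot a a) (_ / _)) divfK //;
  move: h1 h2; rewrite /cross /dot; lra.
Qed.

(** Otherwise the second edge would run back along the first one, and the curve
    would pass twice through the points close to the common vertex. *)
Lemma no_backtrack j : (j.+1 < M)%N -> cross (d j) (d j.+1) = 0 ->
  0 < dot (d j) (d j.+1).
Proof.
move=> jM c0; rewrite ltNge; apply/negP => dle.
have jM' := ltnW jM.
have dj0 := edge_neq0 hxi hX hsimple jM'.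
have dj1 := edge_neq0 hxi hX hsimple jM.
have nj : 0 < dot (d j) (d j).
  by have := cross_self_perp dj0; rewrite /cross /perp /dot /=; lra.
pose lam := - dot (d j) (d j.+1) / dot (d j) (d j).
have lamE : d j.+1 = - lam *: d j.
  by rewrite /lam -mulNr opprK; apply: collinear_scale.
have lam0 : 0 < lam.
  rewrite lt_neqAle divr_ge0 ?oppr_ge0 ?(ltW nj) // andbT.
  apply/eqP => l0; move: dj1; rewrite lamE -l0 oppr0 scale0r eqxx //.
(* [s < 1] and [s * lam < 1]: the point at parameter [s] of the second edge
   is at parameter [1 - s * lam] of the first one. *)
pose s := (2 + lam)^-1.
have s0 : 0 < s by rewrite invr_gt0; lra.
have sE : s * (2 + lam) = 1 by rewrite mulVf // gt_eqF //; lra.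
have s1 : 0 < s < 1 by rewrite s0 /=; nra.
have t1 : 0 < 1 - s * lam < 1 by apply/andP; split; nra.
have := edge_param_in hxi jM' t1; have := edge_param_in hxi jM s1.
set y := edge_param _ _ s; set x := edge_param _ _ (1 - _) => /andP[y1 _] /andP[_ x1].
suff : x = y by move=> xy; rewrite xy in x1; have := lt_trans x1 y1; rewrite ltxx.
apply: (simple_inj hsimple).
- by have /andP[/ltW -> ->] := edge_param_in01 hxi jM' t1.
- by have /andP[/ltW -> ->] := edge_param_in01 hxi jM s1.
- rewrite !(edge_paramE hxi hX) //; last 2 first.
    by case/andP: s1 => /ltW -> /ltW ->.
    by case/andP: t1 => /ltW -> /ltW ->.
  rewrite lamE [LHS]surjective_pairing [RHS]surjective_pairing !coordE.
  by congr (_, _); ring.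
Qed.

End sides.

(** * Passing a vertex *)

Section vertex.
Variables (R : realType) (M : nat) (xi : nat -> R) (X : R -> R * R).
Hypothesis hxi : partition01 M xi.
Hypothesis hX : vVh M xi X.
Hypothesis hsimple : simple_closed X.

Local Notation V j := (X (xi j)).
Local Notation d j := (X (xi j.+1) - X (xi j)).

Lemma near_line_right (P v : R * R) (Q : set (R * R)) :
  (\forall p \near P, Q p) -> \forall s \near (0 : R)^'+, Q (P + s *: v).
Proof. by move=> /(near_line v) h; exact: cvg_within h. Qed.

Lemma cross_shift j (p : R * R) : cross (d j) (p - V j) = cross (d j) (p - V j.+1).
Proof. by rewrite /cross !coordE; ring. Qed.

Lemma curve_near_vertex j : (j.+1 < M)%N -> \forall p \near V j.+1,
  curve X p -> (exists2 u, 0 <= u & p = V j.+1 + u *: - d j) \/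
               (exists2 u, 0 <= u & p = V j.+1 + u *: d j.+1).
Proof.
move=> jM; have jM' := ltnW jM.
have lt1 := partition_mesh hxi jM; have lt0 := partition_mesh hxi jM'.
have hb : xi j < xi j.+1 < xi j.+2 by apply/andP; split; lra.
have := curve_near_arc hX hsimple (partition_ge0 hxi (ltnW jM')) hb
  (partition_le1 hxi jM).
apply: filterS => p hp [y]; rewrite /= in_itv /= => y01 yp.
have /andP[h1 h2] := hp y y01 yp.
have [le|/ltW le] := leP y (xi j.+1).
  left; exists ((xi j.+1 - y) / (xi j.+1 - xi j)).
    by rewrite divr_ge0 ?(ltW lt0) // subr_ge0.
  rewrite -yp (edge_affine hxi hX jM') ?le ?(ltW h1) //.
  rewrite [LHS]surjective_pairing [RHS]surjective_pairing !coordE.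
  by congr (_, _); field; rewrite gt_eqF.
right; exists ((y - xi j.+1) / (xi j.+2 - xi j.+1)).
  by rewrite divr_ge0 ?(ltW lt1) // subr_ge0.
by rewrite -yp [LHS](edge_affine hxi hX jM) // le ltW.
Qed.

Lemma edge_start j s : (j < M)%N -> 0 < s < 1 ->
  exists2 x, xi j < x < xi j.+1 & X x = V j + s *: d j.
Proof.
move=> jM s1; exists (edge_param xi j s); first exact: (edge_param_in hxi jM).
by case/andP: s1 => /ltW s0 /ltW s1; rewrite (edge_paramE hxi hX) // s0.
Qed.

Lemma edge_end j s : (j < M)%N -> 0 < s < 1 ->
  exists2 x, xi j < x < xi j.+1 & X x = V j.+1 + s *: - d j.
Proof.
move=> jM s1; have s1' : 0 < 1 - s < 1 by case/andP: s1 => ? ?; apply/andP; split; lra.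
have [x xj xE] := edge_start jM s1'; exists x => //; rewrite xE.
rewrite [LHS]surjective_pairing [RHS]surjective_pairing !coordE.
by congr (_, _); ring.
Qed.

(** The set [A] is the sector on the right of both edges, cut off by a box in
    which the curve consists of these edges only.  For a right turn it is the
    intersection of the two right-hand half-planes, which is convex; otherwise
    it is their union, and the two convex pieces have a common point. *)
Lemma vertex_sector j : (j.+1 < M)%N -> exists A : set (R * R),
  [/\ forall p q, A p -> A q -> enclosed X p -> enclosed X q,
      exists2 x, xi j < x < xi j.+1 &
        \forall p \near X x, cross (d j) (p - V j) < 0 -> A p
    & exists2 y, xi j.+1 < y < xi j.+2 &
        \forall p \near X y, cross (d j.+1) (p - V j.+1) < 0 -> A p].
Proof.
move=> jM; have jM' := ltnW jM; set W := V j.+1.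
set a := d j; set b := d j.+1.
have [e e0 he] := near_box (curve_near_vertex jM).
rewrite -/W -/a -/b in he.
pose B := [set p : R * R | `|p.1 - W.1| < e /\ `|p.2 - W.2| < e].
have nearB : \forall p \near W, B p by exact: box_near.
have nearBB P : B P -> \forall p \near P, B p.
  move=> [B1 B2].
  have c1 : `|p.1 - W.1| @[p --> P] --> `|P.1 - W.1|.
    apply: cvg_norm; apply: cvgB; [exact: cvg_fst|exact: cvg_cst].
  have c2 : `|p.2 - W.2| @[p --> P] --> `|P.2 - W.2|.
    apply: cvg_norm; apply: cvgB; [exact: cvg_snd|exact: cvg_cst].
  by apply: filterI; [exact: cvgr_lt c1 _ B1|exact: cvgr_lt c2 _ B2].
pose H1 := [set p : R * R | cross a (p - W) < 0].
pose H2 := [set p : R * R | cross b (p - W) < 0].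
have cB : convex_in_plane B by exact: convex_box.
have cH1 : convex_in_plane H1 by exact: convex_halfplane.
have cH2 : convex_in_plane H2 by exact: convex_halfplane.
have pick v w : exists s, [/\ 0 < s, s < 1, B (W + s *: v) & B (W + s *: w)].
  have h1 := near_line_right v nearB; have h2 := near_line_right w nearB.
  have h3 := nbhs_right_gt (0 : R); have h4 := nbhs_right_lt (@ltr01 R).
  have [s [[s1 s2] [s3 s4]]] :=
    filter_ex (filterI (filterI h1 h2) (filterI h3 h4)).
  by exists s.
have [s [s0 s1 Ba Bb]] := pick (- a) b.
have s01 : 0 < s < 1 by rewrite s0.
have [x xj xE] := edge_end jM' s01; have [y yj yE] := edge_start jM s01.
rewrite -/W -/a -/b in xE yE.
have cav (t : R) v : cross a (W + t *: v - W) = t * cross a v.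
  by rewrite /cross !coordE; ring.
have cbv (t : R) v : cross b (W + t *: v - W) = t * cross b v.
  by rewrite /cross !coordE; ring.
have caa : cross a a = 0 by rewrite /cross; ring.
have cbb : cross b b = 0 by rewrite /cross; ring.
have cba : cross b a = - cross a b by rewrite /cross; ring.
have crN (u v : R * R) : cross u (- v) = - cross u v.
  by rewrite /cross !coordE; ring.
have crD (u v w : R * R) : cross u (v + w) = cross u v + cross u w.
  by rewrite /cross !coordE; ring.
have [c0|c0] := ltP (cross a b) 0.
  exists (H1 `&` H2 `&` B); split.
  - apply: enclosed_convex; first by do 2 apply: convexI => //.
    move=> p [[h1 h2] [b1 b2]] /(he p b1 b2) [] [u u0 pE].
      by move: h1; rewrite /H1 /= pE cav crN caa oppr0 mulr0 ltxx.
    by move: h2; rewrite /H2 /= pE cbv cbb mulr0 ltxx.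
  - exists x => //; rewrite xE.
    have nH2 : \forall p \near W + s *: - a, H2 p.
      by apply: near_cross; rewrite cbv crN cba opprK pmulr_rlt0.
    apply: filterS (filterI nH2 (nearBB _ Ba)) => p [h2 hB] h1.
    by split => //; split => //; rewrite /H1 /= -cross_shift.
  - exists y => //; rewrite yE.
    have nH1 : \forall p \near W + s *: b, H1 p.
      by apply: near_cross; rewrite cav pmulr_rlt0.
    by apply: filterS (filterI nH1 (nearBB _ Bb)) => p [h1 hB] h2; split.
exists ((H1 `|` H2) `&` B).
have off p : (H1 `|` H2) p -> B p -> ~ curve X p.
  move=> h [b1 b2] /(he p b1 b2) [] [u u0 pE].
    case: h; rewrite /H1 /H2 /= pE ?cav ?cbv crN ?caa ?cba ?opprK ltNge.
      by rewrite oppr0 mulr0 lexx.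
    by rewrite mulr_ge0.
  case: h; rewrite /H1 /H2 /= pE ?cav ?cbv ?cbb ltNge.
    by rewrite mulr_ge0.
  by rewrite mulr0 lexx.
have in1 p q : H1 p -> B p -> H1 q -> B q -> enclosed X p -> enclosed X q.
  move=> h1 hB h1' hB'.
  apply: (enclosed_convex (A := H1 `&` B)); first exact: convexI.
  - by move=> r [r1 r2]; apply: off => //; left.
  - by split.
  - by split.
have in2 p q : H2 p -> B p -> H2 q -> B q -> enclosed X p -> enclosed X q.
  move=> h1 hB h1' hB'.
  apply: (enclosed_convex (A := H2 `&` B)); first exact: convexI.
  - by move=> r [r1 r2]; apply: off => //; right.
  - by split.
  - by split.
(* A common direction: the half-planes are not opposite, as the second edge
   does not run back along the first. *)
have [v [va vb]] : exists v, cross a v < 0 /\ cross b v < 0.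
  move: c0; rewrite le_eqVlt => /predU1P[c0|c0]; last first.
    by exists (a - b); rewrite (crD a a (- b)) (crD b a (- b)) !(crN _ b) caa cbb cba add0r subr0 oppr_lt0.
  exists (- perp a); rewrite !crN !oppr_lt0; split.
    exact/cross_self_perp/(edge_neq0 hxi hX hsimple jM').
  have := no_backtrack hxi hX hsimple jM (esym c0).
  by rewrite /cross /dot /perp /=; rewrite -/a -/b; lra.
have [t [t0 _ Bt _]] := pick v v.
have H1t : H1 (W + t *: v) by rewrite /H1 /= cav pmulr_rlt0.
have H2t : H2 (W + t *: v) by rewrite /H2 /= cbv pmulr_rlt0.
split.
- move=> p q [hp Bp] [hq Bq] Ep.
  have Ev : enclosed X (W + t *: v).
    by case: hp => hp; [exact: (in1 p)|exact: (in2 p)].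
  by case: hq => hq; [exact: (in1 (W + t *: v))|exact: (in2 (W + t *: v))].
- exists x => //; rewrite xE; apply: filterS (nearBB _ Ba) => p hB h1.
  by split=> //; left; rewrite /H1 /= -cross_shift.
- exists y => //; rewrite yE; apply: filterS (nearBB _ Bb) => p hB h2.
  by split=> //; right.
Qed.

Lemma right_exterior_vertex j x y : (j.+1 < M)%N ->
  xi j < x < xi j.+1 -> xi j.+1 < y < xi j.+2 ->
  right_exterior xi X j x <-> right_exterior xi X j.+1 y.
Proof.
move=> jM xj yj; have jM' := ltnW jM.
have [A [EA [x' xj' Ax] [y' yj' Ay]]] := vertex_sector jM.
have transfer i i' z z' : (i < M)%N -> (i' < M)%N -> xi i < z < xi i.+1 ->
    xi i' < z' < xi i'.+1 ->
    (\forall p \near X z, cross (d i) (p - V i) < 0 -> A p) ->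
    (\forall p \near X z', cross (d i') (p - V i') < 0 -> A p) ->
    right_exterior xi X i z -> right_exterior xi X i' z'.
  move=> iM iM' zi zi' hz hz' rz.
  have [||p pc [/(_ pc) nE /(_ pc) Ap]] := halfplane_near_nonempty (w := d i)
    (Q := V i) _ _ (filterI rz hz).
  - exact: edge_neq0 hX hsimple _ iM.
  - by rewrite (edge_collinear hxi hX) //; move: zi => /andP[/ltW -> /ltW ->].
  - by apply: filterS hz' => q h /h Aq Eq; apply: nE; apply: (EA q).
split=> r.
  apply: (right_exterior_edge hxi hX hsimple jM yj' yj).
  by apply: (transfer j j.+1 x') => //; exact: (right_exterior_edge hxi hX hsimple jM' xj xj').
apply: (right_exterior_edge hxi hX hsimple jM' xj' xj).
by apply: (transfer j.+1 j y') => //; exact: (right_exterior_edge hxi hX hsimple jM yj yj').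
Qed.

(** The vertices of index [1] to [M - 1] already connect all the edges, which
    keeps the induction free of the identification of [xi M] with [xi 0]. *)
Lemma right_exterior_all i j x y : (i < M)%N -> (j < M)%N ->
  xi i < x < xi i.+1 -> xi j < y < xi j.+1 ->
  right_exterior xi X i x -> right_exterior xi X j y.
Proof.
pose P k := forall z, xi k < z < xi k.+1 -> right_exterior xi X k z.
have mid k : (k < M)%N -> exists z, xi k < z < xi k.+1.
  move=> kM; exists (edge_param xi k (1/2)).
  by apply: (edge_param_in hxi kM); lra.
have P0 k : (k < M)%N -> P k <-> P 0%N.
  elim: k => // k IH kM; rewrite -(IH (ltnW kM)).
  have [z zk] := mid k (ltnW kM); have [z' zk'] := mid _ kM.
  split=> h w wk; first by apply/(right_exterior_vertex kM wk zk')/h.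
  exact/(right_exterior_vertex kM zk wk)/h.
move=> iM jM xi' yj r.
suff : P j by exact.
apply/(P0 _ jM)/(P0 _ iM) => z zi.
exact: (right_exterior_edge hxi hX hsimple iM xi' zi r).
Qed.

End vertex.

(** * Vertical slices of the enclosed region *)

Lemma avoid_seq (R : realType) (a b : R) (s : seq R) : a < b ->
  exists2 x, a < x < b & x \notin s.
Proof.
elim: s a b => [|c s IH] a b ab; first by exists ((a + b) / 2); rewrite ?midf_lt.
have m1 : a < (a + b) / 2 by rewrite midf_lt.
have m2 : (a + b) / 2 < b by rewrite midf_lt.
have [cm|mc] := leP c ((a + b) / 2).
  have [x /andP[x1 x2] xs] := IH _ _ m2; exists x; first by rewrite (lt_trans m1).
  by rewrite inE negb_or xs gt_eqF // (le_lt_trans cm).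
have [x /andP[x1 x2] xs] := IH _ _ m1; exists x; first by rewrite x1 (lt_trans x2).
by rewrite inE negb_or xs lt_eqF // (lt_trans x2).
Qed.

(** The local constants [c y] themselves form a locally constant function,
    because two punctured neighbourhoods that overlap share a point. *)
Lemma punctured_constant (R : realType) (T : Type) (f : R -> T) :
  (forall y, exists c, \forall z \near y^', f z = c) ->
  exists c, forall y, \forall z \near y^', f z = c.
Proof.
move=> /choice[c hc].
have lc y : \forall z \near y, c z = c y.
  have := hc y; rewrite near_withinE => h.
  have {}h := nbhs_interior h; apply: filterS h => z hz.
  have [->//|zy] := eqVneq z y.
  have nz : \forall w \near z^', w != y.
    by apply: cvg_within; exact: open_nbhs_nbhs (conj (@open_neq _ y) zy).
  have hz' : \forall w \near z^', w != y -> f w = c y by exact: cvg_within hz.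
  have [w [[w1 w2] w3]] := filter_ex (filterI (filterI nz hz') (hc z)).
  by rewrite -w3 w2.
exists (c 0) => y.
have -> // : c 0 = c y.
apply: (@locally_constant_itv _ _ c (- `|y| - 1) (`|y| + 1)) => //.
  by have := normr_ge0 y; lra.
by have := ler_norm y; have := ler_norm (- y); rewrite normrN; lra.
Qed.

Lemma near_right_ex (R : realType) (a : R) (Q : set R) :
  (\forall z \near a, Q z) -> exists2 s, 0 < s & Q (a + s).
Proof.
move=> h; have hr : \forall w \near a^'+, Q w by exact: cvg_within h.
have [s [s1 s2]] := @filter_ex _ (a^'+) _ _ (filterI hr (nbhs_right_gt a)).
exists (s - a); first by rewrite subr_gt0.
by rewrite addrC subrK.
Qed.

Section slices.
Variables (R : realType) (M : nat) (xi : nat -> R) (X : R -> R * R).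
Hypothesis hxi : partition01 M xi.
Hypothesis hX : vVh M xi X.
Hypothesis hsimple : simple_closed X.
Hypothesis hccw : counterclockwise M xi X.

Local Notation V j := (X (xi j)).
Local Notation d j := (X (xi j.+1) - X (xi j)).

Definition crossing j (x : R) :=
  ((V j).1 < x < (V j.+1).1) || ((V j.+1).1 < x < (V j).1).

Definition height j (x : R) : R := (V j).2 + (x - (V j).1) / (d j).1 * (d j).2.

(** Such a vertical line meets the curve at interior points of non-vertical
    edges only. *)
Definition generic (x : R) := forall j, (j <= M)%N -> x != (V j).1.

Lemma crossing_slope j x : crossing j x -> (d j).1 != 0.
Proof.
rewrite !coordE subr_eq0 /crossing.
by case/orP => /andP[h1 h2]; [rewrite gt_eqF|rewrite lt_eqF] => //; exact: lt_trans h2.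
Qed.

Lemma crossing_point j x : (j < M)%N -> crossing j x ->
  exists2 z, xi j < z < xi j.+1 & X z = (x, height j x).
Proof.
move=> jM cr; have d0 := crossing_slope cr.
set u := (x - (V j).1) / (d j).1.
have ud : u * (d j).1 = x - (V j).1 by rewrite divfK.
have u01 : 0 < u < 1.
  move: cr d0 ud; rewrite /crossing !coordE; clearbody u.
  by case/orP=> /andP[h1 h2] _ h; apply/andP; split; nra.
have [z zj zE] := edge_start hxi hX jM u01; exists z => //.
rewrite zE [LHS]surjective_pairing !coordE /height -/u; congr (_, _).
by move: ud; rewrite !coordE => ->; ring.
Qed.

Lemma curve_generic x y : generic x -> curve X (x, y) ->
  exists j, [/\ (j < M)%N, crossing j x & y = height j x].
Proof.
move=> gx [z]; rewrite /= in_itv /= => /andP[z0 z1] zE.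
have [h0 h1 _] := hxi.
move: z1; rewrite le_eqVlt => /predU1P[z1|z1].
  by have := gx M (leqnn _); rewrite h1 -z1 zE eqxx.
have [|j jM /andP[jz zj]] := partition_locate hxi (x := z); first by rewrite z0.
move: jz; rewrite le_eqVlt => /predU1P[jz|jz].
  by have := gx j (ltnW jM); rewrite jz zE eqxx.
have [|u u01 zu] := edge_param_surj hxi (x := z) jM; first by rewrite jz.
have u01' := u01; case/andP: u01' => /ltW u0 /ltW u1.
have := edge_paramE hxi hX (u := u) jM; rewrite u0 u1 -zu zE => /(_ isT) xyE.
have xE : x = (V j).1 + u * (d j).1 by have := congr1 fst xyE.
have yE : y = (V j).2 + u * (d j).2 by have := congr1 snd xyE.
have d0 : (d j).1 != 0.
  by apply/eqP => d0; have := gx j (ltnW jM); rewrite xE d0 mulr0 addr0 eqxx.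
exists j; split => //; last by rewrite yE /height xE addrAC subrr add0r mulfK.
rewrite /crossing; have := gx j.+1 jM; have := gx j (ltnW jM).
move: d0 xE; rewrite !coordE => d0 xE _ _.
have [lt|lt|eq] := ltgtP (V j).1 (V j.+1).1.
- by apply/orP; left; rewrite xE; case/andP: u01 => h2 h3; apply/andP; split; nra.
- by apply/orP; right; rewrite xE; case/andP: u01 => h2 h3; apply/andP; split; nra.
- by rewrite eq subrr eqxx in d0.
Qed.

Lemma height_inj i j x : (i < M)%N -> (j < M)%N -> crossing i x ->
  crossing j x -> height i x = height j x -> i = j.
Proof.
move=> iM jM /(crossing_point iM)[z /andP[z1 z2] zE].
move=> /(crossing_point jM)[w /andP[w1 w2] wE] hij.
have zw : z = w.
  apply: (simple_inj hsimple); last by rewrite zE wE hij.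
    rewrite (le_trans (partition_ge0 hxi (ltnW iM)) (ltW z1)).
    by rewrite (lt_le_trans z2) // (partition_le1 hxi iM).
  rewrite (le_trans (partition_ge0 hxi (ltnW jM)) (ltW w1)).
  by rewrite (lt_le_trans w2) // (partition_le1 hxi jM).
have [ij|ji|//] := ltngtP i j.
  have := @partition_le _ _ _ hxi i.+1 j; rewrite ij ltnW // => /(_ isT) h.
  by have := lt_le_trans z2 h; rewrite zw ltNge (ltW w1).
have := @partition_le _ _ _ hxi j.+1 i; rewrite ji ltnW // => /(_ isT) h.
by have := lt_le_trans w2 h; rewrite -zw ltNge (ltW z1).
Qed.

(** The ray lies in the component of its origin. *)
Lemma exterior_ray p (v : R * R) : v != 0 ->
  (forall t : R, 0 <= t -> ~ curve X (p + t *: v)) -> ~ enclosed X p.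
Proof.
move=> v0 h [_]; apply: (unbounded_ray v0) => t t0.
have pE : p + t *: v = p + 1 *: (p + t *: v - p).
  by rewrite scale1r [RHS]addrC subrK.
have := @connected_component_max _ (~` curve X)
  [set p + s *: (p + t *: v - p) | s in `[(0 : R), 1]] p.
apply; last by exists 1; [rewrite /= in_itv /= ler01 lexx|rewrite -pE].
- by exists 0; [rewrite /= in_itv /= lexx ler01|rewrite scale0r addr0].
- move=> _ [s + <-]; rewrite /= in_itv /= => /andP[s0 s1].
  by rewrite addrAC subrr add0r scalerA; apply/h/mulr_ge0.
- exact: segment_connected.
Qed.

(** The orientation hypothesis concerns the normal ray at the point;
    [halfplane_status] extends it to the whole left side. *)
Lemma left_enclosed j x : (j < M)%N -> xi j < x < xi j.+1 ->
  \forall p \near X x, 0 < cross (d j) (p - V j) -> enclosed X p.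
Proof.
move=> jM xj.
have st : (\forall p \near X x, cross (- d j) (p - V j) < 0 -> enclosed X p) \/
    (\forall p \near X x, cross (- d j) (p - V j) < 0 -> ~ enclosed X p).
  apply: halfplane_status.
  have := curve_near_edge hxi hX hsimple jM xj; apply: filterS => p h /h.
  by rewrite crossN => ->; rewrite oppr0 ltxx.
case: st => [h|h].
  by apply: filterS h => p hp; rewrite -oppr_lt0 -crossN.
exfalso.
have h' := near_line_right (perp (d j)) h.
have [s [[s1 s2] s3]] := filter_ex (filterI (filterI h' (hccw jM xj))
  (nbhs_right_gt (0 : R))).
apply: s1 s2.
have := cross_self_perp (edge_neq0 hxi hX hsimple jM).
have : cross (d j) (X x - V j) = 0.
  by rewrite (edge_collinear hxi hX) //; case/andP: xj => /ltW -> /ltW ->.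
set a := d j => h0 h1.
have -> : cross (- a) (X x + s *: perp a - V j) =
    - cross a (X x - V j) - s * cross a (perp a).
  by clearbody a; rewrite /cross !coordE; ring.
by rewrite h0 oppr0 add0r oppr_lt0 mulr_gt0.
Qed.

Lemma cross_vertical j z x y (s : R) : (j < M)%N -> xi j < z < xi j.+1 ->
  X z = (x, y) -> cross (d j) ((x, y + s) - V j) = (d j).1 * s.
Proof.
move=> jM zj zE.
have : cross (d j) (X z - V j) = 0.
  by rewrite (edge_collinear hxi hX) //; case/andP: zj => /ltW -> /ltW ->.
by rewrite zE /cross !coordE /= => h; rewrite -[RHS]addr0 -h; ring.
Qed.

Lemma near_vertical (x y : R) (Q : set (R * R)) : (\forall p \near (x, y), Q p) ->
  \forall z \near y, Q (x, z).
Proof.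
move=> /near_box[e e0 he]; apply/nbhs_ballP; exists e => //= z yz.
by apply: he; rewrite /= ?subrr ?normr0 // distrC.
Qed.

(** Otherwise the whole curve lies on one vertical line, and an enclosed point
    on the left of the first edge could escape horizontally. *)
Lemma exists_slanted_edge : exists2 j, (j < M)%N & (d j).1 != 0.
Proof.
apply: contrapT => no.
have d0 j : (j < M)%N -> (d j).1 = 0.
  by move=> jM; apply/eqP/negP => h; apply: no; exists j => //; apply/negP.
have Vc j : (j <= M)%N -> (V j).1 = (V 0%N).1.
  elim: j => // j IH jM; rewrite -(IH (ltnW jM)).
  by have := d0 j jM; rewrite !coordE => /eqP; rewrite subr_eq0 => /eqP.
have Xc q : curve X q -> q.1 = (V 0%N).1.
  case=> z; rewrite /= in_itv /= => /andP[z0]; rewrite le_eqVlt => /predU1P[->|z1] <-.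
    by case: hxi => _ <- _; apply: Vc.
  have [|j jM /andP[jz zj]] := partition_locate hxi (x := z); first by rewrite z0.
  rewrite (edge_affine hxi hX jM) ?jz ?(ltW zj) //.
  by rewrite !coordE -(Vc j (ltnW jM)); move: (d0 j jM); rewrite !coordE => ->; ring.
have M0 := partition_size_gt0 hxi.
have [|z zj zE] := edge_start hxi hX (s := 1/2) M0; first by lra.
have dn : - d 0%N != 0 by rewrite oppr_eq0 (edge_neq0 hxi hX hsimple).
have := left_enclosed M0 zj => /(halfplane_near_nonempty (Q := V 0%N) dn)[|p].
  by rewrite crossN (edge_collinear hxi hX) ?oppr0 //; case/andP: zj => /ltW -> /ltW ->.
rewrite crossN oppr_lt0 => pc /(_ pc).
have p0 : p.1 - (V 0%N).1 != 0.
  apply/eqP => p0; move: pc; rewrite /cross (d0 _ M0) !coordE p0.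
  by rewrite mul0r mulr0 subr0 ltxx.
apply: (@exterior_ray p (p.1 - (V 0%N).1, 0)).
  by apply: contra p0 => /eqP[->].
move=> t t0 /Xc; rewrite !coordE /= => h.
have : (1 + t) * (p.1 - (V 0%N).1) = 0 by lra.
by move/eqP; rewrite mulf_eq0 (negbTE p0) orbF; apply/negP; lra.
Qed.

(** Above the highest crossing of a generic vertical line one escapes to
    infinity, so the region just above that crossing is not enclosed.  It cannot
    be the left side of the edge, hence it is the right side. *)
Lemma exists_right_exterior : exists j z,
  [/\ (j < M)%N, xi j < z < xi j.+1 & right_exterior xi X j z].
Proof.
have [j0 j0M s0] := exists_slanted_edge.
have [x x0 gx] : exists2 x, crossing j0 x & generic x.
  pose s := [seq (V j).1 | j <- iota 0 M.+1].
  have gs x : x \notin s -> generic x.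
    move=> xs j jM; apply: contra xs => /eqP ->.
    by apply/mapP; exists j => //; rewrite mem_iota ltnS.
  have [lt|lt|eq] := ltgtP (V j0).1 (V j0.+1).1.
  - by have [x xb /gs] := avoid_seq s lt; exists x => //; rewrite /crossing xb.
  - by have [x xb /gs] := avoid_seq s lt; exists x => //; rewrite /crossing xb orbT.
  - by move: s0; rewrite !coordE eq subrr eqxx.
pose k := [arg max_(i > Ordinal j0M | crossing i x) height i x]%O.
have [ck kmax] : crossing k x /\
    forall i : 'I_M, crossing i x -> height i x <= height k x.
  by rewrite /k; case: arg_maxP.
have kM := ltn_ord k.
have [z zk zE] := crossing_point kM ck.
exists (k : nat), z; split => //.
have above y : height k x < y -> ~ enclosed X (x, y).
  move=> ky; apply: (@exterior_ray _ (0, 1)).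
    by apply/eqP => -[/eqP]; rewrite oner_eq0.
  move=> t t0 /=; have -> : (x, y) + t *: (0, 1) = (x, y + t).
    by rewrite [LHS]surjective_pairing !coordE /= mulr0 addr0 mulr1.
  move=> /(curve_generic gx)[i [iM ci yE]].
  by have := kmax (Ordinal iM) ci; rewrite -yE; lra.
have up (Q : set (R * R)) : (\forall p \near X z, Q p) ->
    exists2 s, 0 < s & Q (x, height k x + s).
  rewrite zE => /near_vertical h.
  exact: near_right_ex h.
have [h|//] := right_status hxi hX hsimple kM zk.
have [lt|lt|eq] := ltgtP (d k).1 0.
- have [s sp] := up _ h; rewrite (cross_vertical _ kM zk zE).
  move=> /(_ _)E; exfalso; apply: (above (height k x + s)); rewrite ?ltrDl //.
  by apply: E; rewrite pmulr_llt0.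
- have [s sp] := up _ (left_enclosed kM zk); rewrite (cross_vertical _ kM zk zE).
  move=> /(_ _)E; exfalso; apply: (above (height k x + s)); rewrite ?ltrDl //.
  by apply: E; rewrite mulr_gt0.
- by have := crossing_slope ck; rewrite eq eqxx.
Qed.

Lemma crossing_sides j x : (j < M)%N -> crossing j x ->
  \forall y \near height j x,
    (0 < (d j).1 * (y - height j x) -> enclosed X (x, y)) /\
    ((d j).1 * (y - height j x) < 0 -> ~ enclosed X (x, y)).
Proof.
move=> jM cj; have [z zj zE] := crossing_point jM cj.
have [i [w [iM wi ri]]] := exists_right_exterior.
have r := right_exterior_all hxi hX hsimple iM jM wi zj ri.
have l := left_enclosed jM zj.
have lr : \forall p \near (x, height j x),
    (0 < cross (d j) (p - V j) -> enclosed X p) /\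
    (cross (d j) (p - V j) < 0 -> ~ enclosed X p).
  by rewrite -zE; exact: filterI l r.
apply: filterS (near_vertical lr) => y [].
have := cross_vertical (y - height j x) jM zj zE.
by rewrite (addrC (height j x)) subrK => -> h1 h2; split=> h; [apply: h1|apply: h2].
Qed.

Lemma vertex_bound : exists2 B : R, 0 < B &
  forall j, (j <= M)%N -> `|(V j).1| < B /\ `|(V j).2| < B.
Proof.
exists (1 + \sum_(j < M.+1) (`|(V j).1| + `|(V j).2|)).
  rewrite ltr_pwDl // sumr_ge0 // => i _; exact: addr_ge0.
move=> j; rewrite -ltnS => jM; rewrite (bigD1 (Ordinal jM)) //=.
have : 0 <= \sum_(i < M.+1 | i != Ordinal jM) (`|(V i).1| + `|(V i).2|).
  by rewrite sumr_ge0 // => i _; exact: addr_ge0.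
have := normr_ge0 (V j).1; have := normr_ge0 (V j).2.
by split; lra.
Qed.

Lemma height_bound (B : R) j x : (j < M)%N -> crossing j x ->
  (forall i, (i <= M)%N -> `|(V i).1| < B /\ `|(V i).2| < B) ->
  - B < height j x < B.
Proof.
move=> jM cr hB; have d0 := crossing_slope cr; rewrite /height.
set u := (x - (V j).1) / (d j).1.
have ud : u * (d j).1 = x - (V j).1 by rewrite divfK.
have u01 : 0 < u < 1.
  move: cr d0 ud; rewrite /crossing !coordE; clearbody u.
  by case/orP=> /andP[h1 h2] _ h; apply/andP; split; nra.
have [_] := hB j (ltnW jM); have [_] := hB j.+1 jM.
rewrite !ltr_norml !coordE; clearbody u; move: u01.
by move=> /andP[? ?] /andP[? ?] /andP[? ?]; apply/andP; split; nra.
Qed.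

Lemma exterior_outside (B : R) x y : generic x ->
  (forall i, (i <= M)%N -> `|(V i).1| < B /\ `|(V i).2| < B) ->
  y <= - B \/ B <= y -> ~ enclosed X (x, y).
Proof.
move=> gx hB yB.
pose v : R * R := (0, if y <= - B then -1 else 1).
have v0 : v != 0.
  by apply/eqP => -[/eqP]; case: ifP; rewrite ?oppr_eq0 oner_eq0.
apply: (exterior_ray v0) => t t0.
have -> : (x, y) + t *: v = (x, y + t * (if y <= - B then -1 else 1)).
  by rewrite [LHS]surjective_pairing !coordE /= mulr0 addr0.
move=> /(curve_generic gx)[i [iM ci yE]].
have := height_bound iM ci hB; rewrite -yE; case: ifP yB => h; first by lra.
by case; lra.
Qed.

(** The difference [f] of the two sides is constant near every ordinate, with
    the ordinate itself removed: off the crossings both terms are locally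
    constant, and at a crossing they have the same jump.  So it is constant up
    to its values at the crossings, and it vanishes below the curve. *)
Lemma enclosed_slice x y : generic x ->
  (forall j, (j < M)%N -> crossing j x -> y != height j x) ->
  (\1_(enclosed X) (x, y) : R) =
  \sum_(j < M | crossing j x) Num.sg (d j).1 * (height j x < y)%R%:R.
Proof.
move=> gx yreg.
pose S (z : R) : R := \sum_(j < M | crossing j x) Num.sg (d j).1 * (height j x < z)%R%:R.
pose f (z : R) : R := \1_(enclosed X) (x, z) - S z.
have step (a z : R) : a != z -> \forall w \near z, (a < w)%R = (a < z)%R.
  move=> az; have [lt|lt|eq] := ltgtP a z; last by rewrite eq eqxx in az.
    have h : \forall w \near z, a < w by exact: lt_nbhsr.
    by apply: filterS h => w ->.
  have h : \forall w \near z, w < a by exact: lt_nbhsl.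
  by apply: filterS h => w wa; apply/negbTE; rewrite -leNgt ltW.
have S_near (P : pred 'I_M) (z : R) : (forall j : 'I_M, P j -> height j x != z) ->
    \forall w \near z, \sum_(j < M | P j) Num.sg (d j).1 * (height j x < w)%R%:R =
      \sum_(j < M | P j) Num.sg (d j).1 * (height j x < z)%R%:R.
  move=> hP.
  have : \forall w \near z, forall j : 'I_M, P j -> (height j x < w)%R = (height j x < z)%R.
    apply: (@filter_forall R 'I_M (fun j w => P j ->
      (height j x < w)%R = (height j x < z)%R) (nbhs z) _) => j.
    have [Pj|nPj] := boolP (P j); last by near=> w.
    by apply: filterS (step _ _ (hP j Pj)) => w -> _.
  apply: filterS => w hw; apply: eq_bigr => j Pj; by rewrite hw.
have E_near (z : R) : ~ curve X (x, z) ->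
    \forall w \near z, (\1_(enclosed X) (x, w) : R) = \1_(enclosed X) (x, z).
  move=> /(enclosed_near hX)/near_vertical; apply: filterS => w.
  move=> h; rewrite !indicE; have -> // : ((x, w) \in enclosed X) = ((x, z) \in enclosed X).
  by apply/idP/idP => /set_mem hh; apply/mem_set; [rewrite -h|rewrite h].
have f_near (z : R) : (forall j, (j < M)%N -> crossing j x -> z != height j x) ->
    \forall w \near z, f w = f z.
  move=> zreg; have zc : ~ curve X (x, z).
    move=> /(curve_generic gx)[j [jM cj zE]].
    by have := zreg j jM cj; rewrite zE eqxx.
  have h1 : \forall w \near z, S w = S z.
    by apply: S_near => j cj; rewrite eq_sym zreg.
  by apply: filterS (filterI (E_near z zc) h1) => w; rewrite /f => -[-> ->].
have f_punct (z : R) : exists c, \forall w \near z^', f w = c.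
  have [[k [kM ck zE]]|no] := pselect (exists j, [/\ (j < M)%N, crossing j x & z = height j x]).
    (* the contribution of the other edges, which do not cross at [z] *)
    pose T := \sum_(j < M | crossing j x && (j != Ordinal kM))
      Num.sg (d j).1 * (height j x < z)%R%:R.
    exists ((0 < - (d k).1)%R%:R - T).
    have hT : \forall w \near z, \sum_(j < M | crossing j x && (j != Ordinal kM))
        Num.sg (d j).1 * (height j x < w)%R%:R = T.
      apply: S_near => j /andP[cj jk]; apply: contra jk => /eqP hjz; apply/eqP/val_inj.
      by apply: (@height_inj _ _ x) => //=; rewrite hjz.
    rewrite near_withinE; have := crossing_sides kM ck; rewrite -zE => hs.
    apply: filterS (filterI hs hT) => w [[s1 s2] hTw] wz.
    rewrite /f /S (bigD1 (Ordinal kM)) //= hTw opprD addrA; congr (_ - _).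
    have kd := crossing_slope ck; rewrite -zE indicE.
    have inE : ((x, w) \in enclosed X) = (0 < (d k).1 * (w - z))%R.
      have [h|h|h] := ltgtP 0 ((d k).1 * (w - z)).
      - exact/mem_set/s1.
      - exact/memNset/s2.
      - by move/esym/eqP: h; rewrite mulf_eq0 (negbTE kd) subr_eq0 (negbTE wz).
    rewrite inE oppr_gt0; have [kp|kp|kz] := ltgtP (d k).1 0; last first.
    - by rewrite kz eqxx in kd.
    - rewrite gtr0_sg // pmulr_rgt0 // subr_gt0 mul1r; exact: subrr.
    - rewrite ltr0_sg // nmulr_rgt0 // subr_lt0 mulN1r opprK.
      by move: wz; rewrite neq_lt; case: ltgtP => //= _ _; rewrite ?addr0 ?add0r.
  exists (f z); apply: cvg_within; apply: f_near => j jM cj.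
  by apply/eqP => zE; apply: no; exists j.
have [c hc] := punctured_constant f_punct.
have f_reg (z : R) : (forall j, (j < M)%N -> crossing j x -> z != height j x) -> f z = c.
  move=> zreg; have h1 := f_near z zreg.
  have h2 : \forall w \near z^', f w = f z by exact: cvg_within h1.
  by have [w [<- <-]] := @filter_ex _ (z^') _ _ (filterI h2 (hc z)).
have [B B0 hB] := vertex_bound.
have c0 : c = 0.
  rewrite -(f_reg (- B)); last first.
    by move=> j jM cj; have /andP[h _] := height_bound jM cj hB; rewrite lt_eqF.
  rewrite /f indicE memNset; last by apply: (exterior_outside gx hB); left.
  rewrite /S big1 ?subr0 // => j cj.
  have /andP[h _] := height_bound (ltn_ord j) cj hB.
  by rewrite ltNge (ltW h) mulr0.
by have /eqP := f_reg y yreg; rewrite c0 subr_eq0 => /eqP.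
Unshelve. all: by end_near. Qed.

End slices.

(** * Integrals of piecewise continuous functions *)

Section piecewise.
Variable R : realType.
Notation mu := (@lebesgue_measure R).

(** The function [f] is measurable too: it differs from [g] on a finite set
    only, and every function is measurable on a finite set. *)
Lemma eq_integral_off (D : set R) (s : seq R) (f g : R -> \bar R) :
  measurable D -> measurable_fun D g ->
  (forall x, D x -> x \notin s -> f x = g x) ->
  (\int[mu]_(x in D) f x = \int[mu]_(x in D) g x)%E.
Proof.
move=> mD mg fg; pose N : set R := [set` s].
have cN : countable N by exact/finite_set_countable/finite_seq.
have mc (C : set R) : countable C -> measurable C.
  by apply: countable_measurable => t; exact: measurable_set1.
have mN : measurable N by exact: mc.
apply: ae_eq_integral => //.
  rewrite -(setUIDK D (~` N)); apply/measurable_funU.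
  - exact/measurableI/measurableC.
  - exact/measurableD/measurableC.
  split.
    apply: (eq_measurable_fun g); last first.
      exact: measurable_funS (@subIsetl _ D (~` N)) mg.
    by move=> x /set_mem[Dx /= /negP xs]; rewrite fg.
  move=> _ Y mY; apply: mc; apply: sub_countable cN.
  apply: subset_card_le => x [[_ /contrapT]] //.
exists N; split => //; first exact: countable_lebesgue_measure0.
by move=> x /= /not_implyP[Dx fgx]; apply: contrapT => /negP xs; apply: fgx; exact: fg.
Qed.

Lemma integrable_continuous (a b : R) (g : R -> R) : continuous g ->
  mu.-integrable `[a, b] (EFin \o g).
Proof.
move=> cg; apply: continuous_compact_integrable; first exact: segment_compact.
exact: continuous_subspaceT.
Qed.

Lemma EFin_integral (a b : R) (g : R -> R) : continuous g ->
  (integral a b g)%:E = (\int[mu]_(x in `[a, b]) (g x)%:E)%E.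
Proof.
move=> cg; rewrite /integral /Rintegral fineK //.
exact/integrable_fin_num/integrable_continuous.
Qed.

(** The common shape of the slices of the region, of their lengths and of the
    integrands of the scheme: off a finite set, a sum of continuous functions
    cut off to open intervals. *)
Lemma integral_piecewise (n : nat) (P : pred 'I_n) (a b : 'I_n -> R)
    (g : 'I_n -> R -> R) (D : set R) (s : seq R) (f : R -> \bar R) :
  measurable D ->
  (forall i, `]a i, b i[ `<=` D) -> (forall i, continuous (g i)) ->
  (forall x, D x -> x \notin s ->
    f x = (\sum_(i < n | P i) (if a i < x < b i then g i x else 0))%:E) ->
  (\int[mu]_(x in D) f x = (\sum_(i < n | P i) integral (a i) (b i) (g i))%:E)%E.
Proof.
move=> mD sub cg fE.
pose h i x := (((EFin \o g i) \_ `]a i, b i[) x : \bar R).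
have iab i : mu.-integrable `]a i, b i[ (EFin \o g i).
  by apply: integrableS (integrable_continuous (a i) (b i) (cg i)) => //;
    exact: subset_itv_oo_cc.
have ih i : mu.-integrable D (h i).
  by have := iab i; rewrite integrable_mkcond //; apply: integrableS.
rewrite (@eq_integral_off D s f (fun x => \sum_(i < n | P i) h i x)%E) //.
- rewrite integral_sum // -sumEFin; apply: eq_bigr => i _.
  rewrite /h -integral_mkcondr setIidr // EFin_integral //.
  rewrite integral_itv_bndoo //; exact: measurable_int (iab i).
- by apply: (@measurable_int _ _ _ mu); apply: integrable_sum.
- move=> x Dx xs; rewrite fE // -sumEFin; apply: eq_bigr => i _.
  by rewrite /h patchE mem_setE in_itv /=; case: ifP.
Qed.

Lemma integral_affine (a b c m : R) : a <= b ->
  integral a b (fun x => c + m * x) = (b - a) * (c + m * ((a + b) / 2)).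
Proof.
rewrite le_eqVlt => /predU1P[->|ab].
  by rewrite /integral set_itv1 Rintegral_set1 subrr mul0r.
pose F x := c * x + m / 2 * x ^+ 2.
have dF (x : R) : is_derive x (1 : R) F (c + m * x).
  rewrite /F.
  by apply: is_derive_eq; rewrite /GRing.scale /=; field.
have cg : continuous (fun x : R => c + m * x).
  by move=> x; apply: cvgD; [exact: cvg_cst|apply: cvgM; [exact: cvg_cst|]].
apply: EFin_inj; rewrite EFin_integral // (continuous_FTC2 (F := F) ab).
- by rewrite -EFinB /F; congr (_%:E); field.
- exact: continuous_subspaceT.
- have cF : continuous F.
    by move=> x; apply/differentiable_continuous/derivable1_diffP.
  split; first by move=> x _; exact: ex_derive.
    exact/cvg_at_right_filter/cF.
  exact/cvg_at_left_filter/cF.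
- by move=> x _; rewrite derive1E; exact: derive_val.
Qed.

End piecewise.

(** * The area formula *)

(** The trapezoid form of the shoelace sum, that is minus the integral of the
    ordinate against the abscissa along the polygon. *)
Definition shoelace (R : realType) (M : nat) (xi : nat -> R) (X : R -> R * R) : R :=
  \sum_(j < M) - ((X (xi j.+1)).1 - (X (xi j)).1) *
    (((X (xi j)).2 + (X (xi j.+1)).2) / 2).

Section area.
Variables (R : realType) (M : nat) (xi : nat -> R) (X : R -> R * R).
Hypothesis hxi : partition01 M xi.
Hypothesis hX : vVh M xi X.
Hypothesis hsimple : simple_closed X.
Hypothesis hccw : counterclockwise M xi X.

Local Notation V j := (X (xi j)).
Local Notation d j := (X (xi j.+1) - X (xi j)).
Local Notation mu := (@lebesgue_measure R).

(** Each jump [sg] at height [h] of the indicator contributes [sg * (B - h)],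
    because the slice lies below [B]. *)
Lemma slice_measure (B x : R) : generic M xi X x ->
  (forall i, (i <= M)%N -> `|(V i).1| < B /\ `|(V i).2| < B) ->
  mu (xsection (enclosed X) x) =
    (\sum_(j < M | crossing xi X j x)
       Num.sg (d j).1 * (B - height xi X j x))%:E.
Proof.
move=> gx hB; set A := xsection _ _.
have AE y : A y <-> enclosed X (x, y) by exact: xsectionP.
have oA : open A.
  rewrite openE => y /AE Ey; have [cy _] := Ey.
  by have := near_vertical (enclosed_near hX cy); apply: filterS => z h; apply/AE; rewrite h.
have mA : measurable A by exact: open_measurable.
rewrite -[in LHS](setIT A) -integral_indic //.
pose s := B :: [seq height xi X j x | j <- iota 0 M].
rewrite (@integral_piecewise _ M (fun j => crossing xi X j x)
  (fun j => height xi X j x) (fun=> B)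
  (fun j y => Num.sg (d j).1 + 0 * y) setT s) //.
- congr (_%:E); apply: eq_bigr => j cj; rewrite integral_affine.
    by rewrite mul0r addr0 mulrC.
  by have /andP[_ /ltW] := height_bound (ltn_ord j) cj hB.
- move=> j y; apply: cvgD; first exact: cvg_cst.
  by apply: cvgM; first exact: cvg_cst.
- move=> y _; rewrite inE negb_or => /andP[yB ys]; congr (_%:E).
  have yreg j : (j < M)%N -> crossing xi X j x -> y != height xi X j x.
    move=> jM _; apply: contra ys => /eqP ->.
    by apply/mapP; exists j => //; rewrite mem_iota.
  have -> : (\1_A y : R) = \1_(enclosed X) (x, y).
    by rewrite !indicE /A mem_xsection.
  have [By|yB'] := leP B y.
    rewrite indicE memNset; last first.
      by apply: (exterior_outside hxi hX gx hB); right.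
    by rewrite big1 // => j _; rewrite andbF.
  rewrite (enclosed_slice hxi hX hsimple hccw gx yreg).
  apply: eq_bigr => j _; rewrite andbT mul0r addr0.
  by case: ifP; rewrite ?mulr1 ?mulr0.
Qed.

(** The contribution of an edge to the slices is affine in the abscissa, so it
    integrates to the horizontal extent times the value at the midpoint; the
    terms in [B] cancel because the curve is closed. *)
Lemma area_shoelace : area X = (shoelace M xi X)%:E.
Proof.
have [B B0 hB] := vertex_bound M xi X.
rewrite /area /product_measure1.
pose a (j : 'I_M) := Num.min (V j).1 (V j.+1).1.
pose b (j : 'I_M) := Num.max (V j).1 (V j.+1).1.
have ab j : a j <= b j by rewrite /a /b ge_min le_max lexx.
have crE (j : 'I_M) x : crossing xi X j x = (a j < x < b j).
  rewrite /crossing /a /b; case/orP: (le_total (V j).1 (V j.+1).1) => le.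
    rewrite min_l // max_r // orb_idr // => /andP[h1 h2].
    by have := lt_le_trans (lt_trans h1 h2) le; rewrite ltxx.
  rewrite min_r // max_l // orb_idl // => /andP[h1 h2].
  by have := lt_le_trans (lt_trans h1 h2) le; rewrite ltxx.
(* [c j + m j * x] is [sg * (B - height)] as an affine function of [x] *)
pose m (j : 'I_M) := - Num.sg (d j).1 * ((d j).2 / (d j).1).
pose c (j : 'I_M) := Num.sg (d j).1 *
  (B - (V j).2 + (V j).1 / (d j).1 * (d j).2).
rewrite (@integral_piecewise _ M xpredT a b (fun j x => c j + m j * x) setT
  [seq (V j).1 | j <- iota 0 M.+1]) //; first last.
- move=> x _ xs.
  have gx : generic M xi X x.
    move=> j jM; apply: contra xs => /eqP ->.
    by apply/mapP; exists j => //; rewrite mem_iota ltnS.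
  rewrite /= (slice_measure gx hB); congr (_%:E).
  rewrite big_mkcond; apply: eq_bigr => j _; rewrite crE; case: ifP => // _.
  by rewrite /c /m /height; ring.
- move=> j y; apply: cvgD; first exact: cvg_cst.
  by apply: cvgM; first exact: cvg_cst.
congr (_%:E).
have tel : \sum_(j < M) ((V j.+1).1 - (V j).1) = 0.
  rewrite -(big_mkord xpredT (fun j => (V j.+1).1 - (V j).1)) telescope_sumr //.
  by have [-> -> _] := hxi; have [-> _] := hsimple; rewrite subrr.
apply/eqP; rewrite -subr_eq0 /shoelace -sumrB; apply/eqP.
transitivity (B * \sum_(j < M) ((V j.+1).1 - (V j).1)); last by rewrite tel mulr0.
rewrite mulr_sumr.
apply: eq_bigr => j _; rewrite integral_affine // /c /m !coordE /a /b.
have [lt|lt|->] := ltgtP (V j).1 (V j.+1).1.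
- rewrite gtr0_sg ?subr_gt0 //; field.
  by rewrite subr_eq0 gt_eqF.
- rewrite ltr0_sg ?subr_lt0 //; field.
  by rewrite subr_eq0 lt_eqF.
- by rewrite subrr; ring.
Qed.

End area.

(** * Piecewise continuous functions on a partition *)

Lemma derive1_affine (R : realType) (W : normedModType R) (f : R -> W)
    (x c : R) (A B : W) :
  (\forall y \near x, f y = A + (y - c) *: B) -> derive1 f x = B.
Proof.
move=> fE; rewrite /derive1; apply: lim_near_cst; first exact: norm_hausdorff.
have fx : f x = A + (x - c) *: B by exact: nbhs_singleton fE.
have fh : \forall h \near (0 : R), f (h + x) = A + (h + x - c) *: B.
  have /nbhs_ballP[e e0 he] := fE; apply/nbhs_ballP; exists e => //= h.
  rewrite /ball /= sub0r normrN => hlt; apply: he.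
  by rewrite /ball /= opprD addrCA subrr addr0 normrN.
rewrite near_withinE; apply: filterS fh => h fh h0.
rewrite fh fx opprD addrACA subrr add0r -scalerBl.
have -> : h + x - c - (x - c) = h by ring.
by rewrite scalerA mulVf // scale1r.
Qed.

Section pwc.
Variables (R : realType) (M : nat) (xi : nat -> R).
Hypothesis hxi : partition01 M xi.

(** The values at the nodes are left free, since derivatives of members of the
    finite element spaces need not exist there. *)
Definition pwc (f : R -> R) := exists2 g : nat -> R -> R,
  (forall j, continuous (g j)) &
  (forall j x, (j < M)%N -> xi j < x < xi j.+1 -> f x = g j x).

Lemma integral_pwc (f : R -> R) (g : nat -> R -> R) :
  (forall j, continuous (g j)) ->
  (forall j x, (j < M)%N -> xi j < x < xi j.+1 -> f x = g j x) ->
  integral 0 1 f = \sum_(j < M) integral (xi j) (xi j.+1) (g j).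
Proof.
move=> cg fg; rewrite /integral /Rintegral.
pose s := [seq xi j | j <- iota 0 M.+1].
rewrite (@integral_piecewise _ M xpredT (fun j => xi j) (fun j => xi j.+1)
  (fun j => g j) `[0, 1] s) //.
- move=> j x; rewrite /= !in_itv /= => /andP[h1 h2].
  rewrite (le_trans (partition_ge0 hxi (ltnW (ltn_ord j))) (ltW h1)).
  exact: le_trans (ltW h2) (partition_le1 hxi (ltn_ord j)).
- move=> x; rewrite /= in_itv /= => /andP[x0 x1] xs; congr (_%:E).
  have xn j : (j <= M)%N -> x != xi j.
    move=> jM; apply: contra xs => /eqP ->.
    by apply: map_f; rewrite mem_iota ltnS.
  have [h0 h1 _] := hxi.
  have x1' : x < 1 by rewrite lt_neqAle x1 andbT -h1 xn.
  have [|j jM /andP[jx xj]] := partition_locate hxi (x := x); first by rewrite x0.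
  have jx' : xi j < x by rewrite lt_neqAle jx andbT eq_sym xn // ltnW.
  rewrite (bigD1 (Ordinal jM)) //= jx' xj (fg j) ?jx' // big1 ?addr0 // => i ij.
  case: ifP => // /andP[i1 i2]; case/negP: ij; apply/eqP/val_inj => /=.
  have [lt|lt|//] := ltngtP i j.
    have := @partition_le _ _ _ hxi i.+1 j; rewrite lt ltnW // => /(_ isT) h.
    by have := lt_trans (lt_le_trans i2 h) jx'; rewrite ltxx.
  have := @partition_le _ _ _ hxi j.+1 i; rewrite lt ltnW // => /(_ isT) h.
  by have := lt_trans (lt_le_trans xj h) i1; rewrite ltxx.
Qed.

Lemma pwcD f g : pwc f -> pwc g -> pwc (fun x => f x + g x).
Proof.
move=> [f' cf fE] [g' cg gE]; exists (fun j x => f' j x + g' j x).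
  by move=> j x; apply: cvgD; [exact: cf|exact: cg].
by move=> j x jM xj; rewrite (fE j) // (gE j).
Qed.

Lemma pwcM f g : pwc f -> pwc g -> pwc (fun x => f x * g x).
Proof.
move=> [f' cf fE] [g' cg gE]; exists (fun j x => f' j x * g' j x).
  by move=> j x; apply: cvgM; [exact: cf|exact: cg].
by move=> j x jM xj; rewrite (fE j) // (gE j).
Qed.

Lemma pwc_const f (c : nat -> R) :
  (forall j x, (j < M)%N -> xi j < x < xi j.+1 -> f x = c j) -> pwc f.
Proof. by move=> fc; exists (fun j => cst (c j)) => // j; exact: cst_continuous. Qed.

Lemma pwc_affine f :
  (forall j, (j < M)%N -> P1_on (xi j) (xi j.+1) f) -> pwc f.
Proof.
move=> h; exists (fun j x => f (xi j) +
    (x - xi j) / (xi j.+1 - xi j) * (f (xi j.+1) - f (xi j))).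
  move=> j x; apply: cvgD; first exact: cvg_cst.
  apply: cvgM; last exact: cvg_cst.
  apply: cvgM; last exact: cvg_cst.
  by apply: cvgB => //; exact: cvg_cst.
move=> j x jM /andP[h1 h2]; apply: P1_on_affine; last by rewrite !ltW.
  exact: lt_trans h2.
exact: h.
Qed.

Lemma integral_pwcZ (c : R) f : pwc f ->
  integral 0 1 (fun x => c * f x) = c * integral 0 1 f.
Proof.
move=> [f' cf fE]; rewrite (integral_pwc cf fE) mulr_sumr.
rewrite (@integral_pwc (fun x => c * f x) (fun j x => c * f' j x)).
- apply: eq_bigr => j _; rewrite /integral RintegralZl //.
  exact: integrable_continuous.
- by move=> j x; apply: cvgM; [exact: cvg_cst|exact: cf].
- by move=> j x jM xj; rewrite (fE j).
Qed.

Lemma integral_pwcD f g : pwc f -> pwc g ->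
  integral 0 1 (fun x => f x + g x) = integral 0 1 f + integral 0 1 g.
Proof.
move=> [f' cf fE] [g' cg gE]; rewrite (integral_pwc cf fE) (integral_pwc cg gE).
rewrite (@integral_pwc (fun x => f x + g x) (fun j x => f' j x + g' j x)).
- rewrite -big_split; apply: eq_bigr => j _; rewrite /integral RintegralD //;
  exact: integrable_continuous.
- by move=> j x; apply: cvgD; [exact: cf|exact: cg].
- by move=> j x jM xj; rewrite (fE j) // (gE j).
Qed.

End pwc.

(** * The scheme on one edge *)

Lemma dotZl (R : realType) (c : R) (a b : R * R) : dot (c *: a) b = c * dot a b.
Proof. by rewrite /dot !coordE; ring. Qed.

Lemma dotC (R : realType) (a b : R * R) : dot a b = dot b a.
Proof. by rewrite /dot; ring. Qed.

Lemma dotDl (R : realType) (a b c : R * R) : dot (a + b) c = dot a c + dot b c.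
Proof. by rewrite /dot !coordE; ring. Qed.

Lemma dot_gt0 (R : realType) (a : R * R) : a != 0 -> 0 < dot a a.
Proof. by move=> /cross_self_perp; rewrite /cross /perp /dot /=; lra. Qed.

Lemma enormZ (R : realType) (c : R) (a : R * R) : enorm (c *: a) = `|c| * enorm a.
Proof.
rewrite /enorm dotZl dotC dotZl mulrA -expr2 sqrtrM ?sqr_ge0 //.
by rewrite sqrtr_sqr.
Qed.

Lemma enorm_gt0 (R : realType) (a : R * R) : a != 0 -> 0 < enorm a.
Proof. by move=> /dot_gt0; rewrite /enorm sqrtr_gt0. Qed.

Section edges.
Variables (R : realType) (M : nat) (xi : nat -> R).
Hypothesis hxi : partition01 M xi.

Lemma derive1_vVh j (X : R -> R * R) x : vVh M xi X -> (j < M)%N ->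
  xi j < x < xi j.+1 ->
  derive1 X x = (xi j.+1 - xi j)^-1 *: (X (xi j.+1) - X (xi j)).
Proof.
move=> hX jM xj; apply: (@derive1_affine _ _ _ _ (xi j) (X (xi j))).
apply: filterS (near_between xj) => y /andP[h1 h2].
by rewrite [LHS](edge_affine hxi hX jM) ?(ltW h1) ?(ltW h2) // scalerA.
Qed.

Lemma perimeterE (X : R -> R * R) : vVh M xi X ->
  perimeter X = \sum_(j < M) enorm (X (xi j.+1) - X (xi j)).
Proof.
move=> hX; pose e j := enorm (X (xi j.+1) - X (xi j)) / (xi j.+1 - xi j).
rewrite /perimeter (integral_pwc hxi (g := fun j x => e j + 0 * x)).
- apply: eq_bigr => j _; have lt := partition_mesh hxi (ltn_ord j).
  rewrite integral_affine; last by rewrite -subr_ge0 ltW.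
  by rewrite mul0r addr0 /e mulrC divfK // gt_eqF.
- move=> j x; apply: cvgD; first exact: cvg_cst.
  by apply: cvgM; first exact: cvg_cst.
- move=> j x jM xj; have lt := partition_mesh hxi jM.
  rewrite (derive1_vVh hX jM xj) enormZ mul0r addr0 /e mulrC gtr0_norm //.
  by rewrite invr_gt0.
Qed.

Variables (tau : R) (n : nat) (X0 X1 : R -> R * R).
Hypothesis tau0 : 0 < tau.
Hypothesis n0 : (0 < n)%N.
Hypothesis hX0 : vVh M xi X0.
Hypothesis hX1 : vVh M xi X1.

Local Notation t0 := (tnode tau n.-1).
Local Notation t1 := (tnode tau n).

Lemma tnode_diff : t1 - t0 = tau.
Proof. by case: n n0 => // k _; rewrite /tnode /= -natr1; ring. Qed.

Lemma tnode_lt : t0 < t1.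
Proof. by rewrite -subr_gt0 tnode_diff. Qed.

(** The vector from [xi j] to [xi j.+1] of the polygon at time [t]. *)
Definition edge_vec j t : R * R :=
  ((t1 - t) / tau) *: (X0 (xi j.+1) - X0 (xi j)) +
  ((t - t0) / tau) *: (X1 (xi j.+1) - X1 (xi j)).

(** The time average of [edge_vec], which is affine in time. *)
Definition edge_mean j : R * R :=
  2^-1 *: ((X0 (xi j.+1) - X0 (xi j)) + (X1 (xi j.+1) - X1 (xi j))).

Lemma dXhE j t x : (j < M)%N -> xi j < x < xi j.+1 ->
  dXh tau n X0 X1 t x = (xi j.+1 - xi j)^-1 *: edge_vec j t.
Proof.
move=> jM xj; apply: (@derive1_affine _ _ _ _ (xi j) (Xh tau n X0 X1 t (xi j))).
apply: filterS (near_between xj) => y /andP[h1 h2].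
rewrite /Xh (edge_affine hxi hX0 jM) ?(ltW h1) ?(ltW h2) //.
rewrite (edge_affine hxi hX1 jM) ?(ltW h1) ?(ltW h2) // /edge_vec.
rewrite [LHS]surjective_pairing [RHS]surjective_pairing !coordE.
by congr (_, _); ring.
Qed.

Lemma edge_vec_t0 j : edge_vec j t0 = X0 (xi j.+1) - X0 (xi j).
Proof.
by rewrite /edge_vec tnode_diff divff ?gt_eqF // subrr mul0r scale0r scale1r addr0.
Qed.

Lemma edge_vec_t1 j : edge_vec j t1 = X1 (xi j.+1) - X1 (xi j).
Proof.
by rewrite /edge_vec tnode_diff divff ?gt_eqF // subrr mul0r scale0r scale1r add0r.
Qed.

Lemma integral_time_affine (k a b : R) :
  integral t0 t1 (fun t => k * ((t1 - t) / tau * a + (t - t0) / tau * b)) =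
  tau * k * (2^-1 * (a + b)).
Proof.
have -> : (fun t => k * ((t1 - t) / tau * a + (t - t0) / tau * b)) =
    (fun t => k * (t1 * a - t0 * b) / tau + k * ((b - a) / tau) * t).
  by apply/funext => t; ring.
have tE : t1 = t0 + tau by have := tnode_diff; lra.
rewrite integral_affine ?(ltW tnode_lt) // tnode_diff tE.
by field; rewrite gt_eqF.
Qed.

Lemma tauhnE j x : (j < M)%N -> xi j < x < xi j.+1 ->
  tauhn tau n X0 X1 x = (tau / (xi j.+1 - xi j)) *: edge_mean j.
Proof.
move=> jM xj; rewrite [RHS]surjective_pairing /tauhn /vintegral !coordE.
congr (_, _); rewrite -integral_time_affine; congr (integral _ _ _);
  by apply/funext => t; rewrite (dXhE _ jM xj) /edge_vec !coordE.
Qed.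

Lemma nuhnE j x : (j < M)%N -> xi j < x < xi j.+1 ->
  nuhn tau n X0 X1 x = (tau / (xi j.+1 - xi j)) *: perp (edge_mean j).
Proof.
move=> jM xj; rewrite [RHS]surjective_pairing /nuhn /vintegral !coordE.
have pE (v : R * R) : ((perp v).1 = - v.2) * ((perp v).2 = v.1) by [].
have -> : (perp (edge_mean j)).1 = 2^-1 * (- (X0 (xi j.+1) - X0 (xi j)).2 +
    - (X1 (xi j.+1) - X1 (xi j)).2).
  by rewrite /perp /edge_mean !coordE /=; ring.
congr (_, _); rewrite -integral_time_affine; congr (integral _ _ _);
  apply/funext => t; rewrite (dXhE _ jM xj) pE /edge_vec !coordE //.
by ring.
Qed.

Lemma rhohn_ge0 x : 0 <= rhohn tau n X0 X1 x.
Proof. by apply: Rintegral_ge0 => t _; rewrite invr_ge0 sqrtr_ge0. Qed.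

Lemma pwc_nuhn1 : pwc M xi (fun x => (nuhn tau n X0 X1 x).1).
Proof. by apply: pwc_const => j x jM xj; rewrite (nuhnE jM xj). Qed.

Lemma pwc_nuhn2 : pwc M xi (fun x => (nuhn tau n X0 X1 x).2).
Proof. by apply: pwc_const => j x jM xj; rewrite (nuhnE jM xj). Qed.

Lemma pwc_tauhn1 : pwc M xi (fun x => (tauhn tau n X0 X1 x).1).
Proof. by apply: pwc_const => j x jM xj; rewrite (tauhnE jM xj). Qed.

Lemma pwc_tauhn2 : pwc M xi (fun x => (tauhn tau n X0 X1 x).2).
Proof. by apply: pwc_const => j x jM xj; rewrite (tauhnE jM xj). Qed.

End edges.

(** * Conservation of the area *)

Section scheme.
Variables (R : realType) (M : nat) (xi : nat -> R).
Hypothesis hxi : partition01 M xi.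
Variables (tau : R) (n : nat) (X0 X1 : R -> R * R) (p q : R -> R).
Hypothesis tau0 : 0 < tau.
Hypothesis n0 : (0 < n)%N.
Hypothesis hX0 : vVh M xi X0.
Hypothesis hX1 : vVh M xi X1.
Hypothesis hp : Vh M xi p.
Hypothesis hq : Vh M xi q.
Hypothesis hsol : scheme_solution M xi tau n X0 X1 p q.

Local Notation t0 := (tnode tau n.-1).
Local Notation t1 := (tnode tau n).
Local Notation W x := (X1 x - X0 x).

Lemma Vh_cst (c : R) : Vh M xi (cst c).
Proof.
split=> [|//|j jM]; first by apply: continuous_subspaceT => x; exact: cvg_cst.
exists c%:P; last by move=> x _; rewrite hornerC.
by rewrite (leq_trans (size_polyC_leq1 c)).
Qed.

Lemma closed_node (X : R -> R * R) : vVh M xi X -> X (xi M) = X (xi 0%N).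
Proof. by case=> _ X01 _; have [-> -> _] := hxi. Qed.

(** The first equation tested with 1 says that the sum of
    [dot w_j (perp e_j)] vanishes, where [w_j] is the mean of [X1 - X0] on the
    edge and [e_j] the mean edge vector.  This is minus the increment of the
    shoelace sum, up to the telescoping terms [G]. *)
Lemma shoelace_conserved : shoelace M xi X1 = shoelace M xi X0.
Proof.
have [eq1 _ _] := hsol; have := eq1 _ (Vh_cst 1).
have -> : integral 0 1 (fun x => derive1 p x * derive1 (cst 1 : R -> R) x *
    rhohn tau n X0 X1 x) = 0.
  rewrite -[RHS](mul0r (integral 0 1 (cst 1))) -(integral_pwcZ hxi); last first.
    by apply: (pwc_const (c := fun=> 1)).
  congr (integral _ _ _); apply/funext => x.
  by rewrite (_ : derive1 (cst 1 : R -> R) x = 0) ?mulr0 ?mul0r // derive1_cst.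
pose pm j := perp (edge_mean xi X0 X1 j).
pose dW j := W (xi j.+1) - W (xi j).
pose len j := xi j.+1 - xi j.
(* the integrand on the edge [j] is [c j + m j * x] *)
pose m j := dot (dW j) (pm j) / len j / len j.
pose c j := (dot (W (xi j)) (pm j) - xi j * (dot (dW j) (pm j) / len j)) / len j.
rewrite (integral_pwc hxi (g := fun j x => c j + m j * x)); first last.
- move=> j x jM xj; have lt := partition_mesh hxi jM.
  rewrite (nuhnE hxi tau0 n0 hX0 hX1 jM xj) scale1r dotZl dotC dotZl.
  rewrite -/(pm j) dotC mulrA.
  have -> : W x = W (xi j) + ((x - xi j) / len j) *: dW j.
    have xj' : xi j <= x <= xi j.+1 by case/andP: xj => /ltW -> /ltW ->.
    rewrite (edge_affine hxi hX0 jM xj') (edge_affine hxi hX1 jM xj') /dW /len.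
    rewrite [LHS]surjective_pairing [RHS]surjective_pairing !coordE.
    by congr (_, _); ring.
  rewrite dotDl dotZl /c /m /len; field; rewrite gt_eqF //=.
  by rewrite gt_eqF.
- move=> j x; apply: cvgD; first exact: cvg_cst.
  by apply: cvgM; first exact: cvg_cst.
move=> S0.
pose G j : R := - (4^-1 * (cross (W (xi j)) (X0 (xi j) + X1 (xi j)))) -
  2^-1 * ((X1 (xi j)).1 * (X1 (xi j)).2 - (X0 (xi j)).1 * (X0 (xi j)).2).
have tel : \sum_(j < M) (G j.+1 - G j) = 0.
  rewrite -(big_mkord xpredT (fun j => G j.+1 - G j)) telescope_sumr //.
  by rewrite /G !closed_node // subrr.
apply/eqP; rewrite -subr_eq0; apply/eqP.
transitivity (\sum_(j < M) (G j.+1 - G j) -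
  \sum_(j < M) integral (xi j) (xi j.+1) (fun x => c j + m j * x));
  last by rewrite tel S0 subrr.
rewrite /shoelace -!sumrB; apply: eq_bigr => j _.
have lt := partition_mesh hxi (ltn_ord j).
rewrite integral_affine; last by rewrite -subr_ge0 ltW.
have -> : (xi j.+1 - xi j) * (c j + m j * ((xi j + xi j.+1) / 2)) =
    dot (W (xi j)) (pm j) + dot (dW j) (pm j) / 2.
  by rewrite /c /m /len; field; rewrite gt_eqF.
by rewrite /dot /pm /dW /G /cross /perp /edge_mean !coordE /=; field.
Qed.

End scheme.

(** * Decrease of the perimeter *)

Lemma frac_id (R : realType) (x : R) : 0 <= x < 1 -> frac x = x.
Proof. by move=> x01; rewrite /frac (floor_def (m := 0)) ?subr0 // add0r. Qed.

Lemma frac_sub1 (R : realType) (x : R) : 1 <= x < 2 -> frac x = x - 1.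
Proof. by move=> x12; rewrite /frac (floor_def (m := 1)). Qed.

Lemma dotBl (R : realType) (a b c : R * R) : dot (a - b) c = dot a c - dot b c.
Proof. by rewrite /dot !coordE; ring. Qed.

Lemma dotBr (R : realType) (a b c : R * R) : dot a (b - c) = dot a b - dot a c.
Proof. by rewrite /dot !coordE; ring. Qed.

Section perimeter.
Variables (R : realType) (M : nat) (xi : nat -> R).
Hypothesis hxi : partition01 M xi.
Variables (tau : R) (n : nat) (X0 X1 : R -> R * R) (p q : R -> R).
Hypothesis tau0 : 0 < tau.
Hypothesis n0 : (0 < n)%N.
Hypothesis hX0 : vVh M xi X0.
Hypothesis hX1 : vVh M xi X1.
Hypothesis hp : Vh M xi p.
Hypothesis hq : Vh M xi q.
Hypothesis hreg : forall t j x, tnode tau n.-1 <= t <= tnode tau n -> (j < M)%N ->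
       xi j < x < xi j.+1 -> dXh tau n X0 X1 t x <> 0.
Hypothesis hsol : scheme_solution M xi tau n X0 X1 p q.

Local Notation t0 := (tnode tau n.-1).
Local Notation t1 := (tnode tau n).
Local Notation W x := (X1 x - X0 x).
Local Notation evec := (edge_vec xi tau n X0 X1).
Local Notation mu := (@lebesgue_measure R).

Lemma vVh_sub : vVh M xi (fun x => W x).
Proof.
have [c0 p0 a0] := hX0; have [c1 p1 a1] := hX1.
have P1B a b (f g : R -> R) : P1_on a b f -> P1_on a b g -> P1_on a b (fun x => f x - g x).
  move=> [u su fu] [v sv gv]; exists (u - v).
    by rewrite (leq_trans (size_polyD _ _)) // size_polyN geq_max su sv.
  by move=> x xab; rewrite fu // gv // hornerD hornerN.
split.
- by move=> x; apply: cvgB; [exact: c1|exact: c0].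
- by rewrite p0 p1.
- by move=> j jM; have [? ?] := a0 j jM; have [? ?] := a1 j jM; split; exact: P1B.
Qed.

Lemma pwc_dot (a b : R -> R * R) :
  pwc M xi (fun x => (a x).1) -> pwc M xi (fun x => (a x).2) ->
  pwc M xi (fun x => (b x).1) -> pwc M xi (fun x => (b x).2) ->
  pwc M xi (fun x => dot (a x) (b x)).
Proof. by move=> a1 a2 b1 b2; apply: pwcD; apply: pwcM. Qed.

Lemma pwc_Vh f : Vh M xi f -> pwc M xi f.
Proof. by case=> _ _ h; apply: pwc_affine. Qed.

Lemma pwc_vVh X : vVh M xi X ->
  pwc M xi (fun x => (X x).1) /\ pwc M xi (fun x => (X x).2).
Proof.
by case=> _ _ h; split; apply: pwc_affine => // j jM; have [] := h j jM.
Qed.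

(** The first equation tested with [p] and the second with [q] turn this
    integral into [tau] times the integral of [p'^2 rho]. *)
Lemma dissipation :
  0 <= integral 0 1 (fun x => dot (p x *: nuhn tau n X0 X1 x +
                               q x *: tauhn tau n X0 X1 x) (W x)).
Proof.
have [eq1 eq2 _] := hsol.
have [w1 w2] := pwc_vVh vVh_sub.
have cst_pwc (k : R) : pwc M xi (fun _ => k) by apply: (pwc_const (c := fun=> k)).
pose I1 x := dot (tau^-1 *: W x) (p x *: nuhn tau n X0 X1 x).
pose I2 x := dot (tau^-1 *: W x) (q x *: tauhn tau n X0 X1 x).
have -> : (fun x => dot (p x *: nuhn tau n X0 X1 x + q x *: tauhn tau n X0 X1 x)
    (W x)) = (fun x => tau * I1 x + tau * I2 x).
  apply/funext => x; rewrite /I1 /I2 !dotZl !(dotC (W x)) dotDl.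
  by rewrite !mulrA mulfV ?gt_eqF // !mul1r.
have tw1 : pwc M xi (fun x => (tau^-1 *: W x).1) by exact: pwcM (cst_pwc _) w1.
have tw2 : pwc M xi (fun x => (tau^-1 *: W x).2) by exact: pwcM (cst_pwc _) w2.
have c1 : pwc M xi I1.
  apply: (pwc_dot tw1 tw2).
    exact: pwcM (pwc_Vh hp) (pwc_nuhn1 hxi tau0 n0 hX0 hX1).
  exact: pwcM (pwc_Vh hp) (pwc_nuhn2 hxi tau0 n0 hX0 hX1).
have c2 : pwc M xi I2.
  apply: (pwc_dot tw1 tw2).
    exact: pwcM (pwc_Vh hq) (pwc_tauhn1 hxi tau0 n0 hX0 hX1).
  exact: pwcM (pwc_Vh hq) (pwc_tauhn2 hxi tau0 n0 hX0 hX1).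
have tc1 : pwc M xi (fun x => tau * I1 x) by exact: pwcM (cst_pwc _) c1.
have tc2 : pwc M xi (fun x => tau * I2 x) by exact: pwcM (cst_pwc _) c2.
rewrite (integral_pwcD hxi tc1 tc2) !(integral_pwcZ hxi) //.
rewrite (eq2 _ hq) mulr0 addr0 (eq1 _ hp) mulr_ge0 ?(ltW tau0) //.
apply: Rintegral_ge0 => x _; rewrite mulr_ge0 ?rhohn_ge0 //.
by rewrite -expr2 sqr_ge0.
Qed.

Definition tangent j t : R * R := (enorm (evec j t))^-1 *: evec j t.

Lemma tauhE j t x : (j < M)%N -> xi j < x < xi j.+1 ->
  tauh tau n X0 X1 t x = tangent j t.
Proof.
move=> jM xj; have lt := partition_mesh hxi jM.
rewrite /tauh (dXhE hxi _ _ hX0 hX1 _ jM xj) enormZ gtr0_norm ?invr_gt0 //.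
rewrite /tangent scalerA invfM invrK; congr (_ *: _).
by rewrite mulrAC divff ?mul1r // gt_eqF.
Qed.

(** The edge that starts at node [j]: the node [xi M = 1] is identified with
    [xi 0 = 0]. *)
Definition cyc j := if j == M then 0%N else j.

(** The tangent is constant on each open edge, so the difference of which the
    jump is the limit is eventually constant. *)
Lemma jump_tauh j t : (j < M)%N ->
  jump (tauh tau n X0 X1 t) (xi j.+1) = tangent (cyc j.+1) t - tangent j t.
Proof.
move=> jM.
apply: (@lim_near_cst ((R * R)%type : pseudoMetricNormedZmodType R)).
  exact: norm_hausdorff.
have [h0 h1 _] := hxi.
have small (e : R) : 0 < e -> \forall s \near (0 : R)^'+, 0 < s < e.
  by move=> e0; near=> s; apply/andP; split; near: s;
    [exact: nbhs_right_gt|exact: nbhs_right_lt].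
have left_ (s : R) : 0 < s < xi j.+1 - xi j ->
    tauh tau n X0 X1 t (frac (xi j.+1 - s)) = tangent j t.
  move=> /andP[s0 s1]; have j0 := partition_ge0 hxi (ltnW jM).
  have j1 := partition_le1 hxi jM.
  by rewrite frac_id ?(tauhE _ jM) //; apply/andP; split; lra.
have := small _ (partition_mesh hxi jM).
have [jM'|jM'] := eqVneq j.+1 M.
  have M0 := partition_size_gt0 hxi.
  have := small _ (partition_mesh hxi M0) => hr hl.
  rewrite /cyc jM' eqxx.
  apply: filterS (filterI hr hl) => s [/andP[s0 s1] sl].
  rewrite -jM' left_ // jM' h1 frac_sub1; last first.
    have := partition_le1 hxi M0; rewrite h0 in s1 *; lra.
  rewrite (tauhE _ M0) // h0; rewrite h0 in s1; apply/andP; split; lra.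
have jM1 : (j.+1 < M)%N by rewrite ltn_neqAle jM' jM.
have := small _ (partition_mesh hxi jM1) => hr hl.
rewrite /cyc (negbTE jM').
apply: filterS (filterI hr hl) => s [/andP[s0 s1] sl].
have ge := partition_ge0 hxi (ltnW jM1); have le := partition_le1 hxi jM1.
rewrite left_ // frac_id; last by apply/andP; split; lra.
by rewrite (tauhE _ jM1) //; apply/andP; split; lra.
Unshelve. all: by end_near. Qed.

Lemma edge_vec_neq0 j t : (j < M)%N -> t0 <= t <= t1 -> evec j t != 0.
Proof.
move=> jM tt; apply/eqP => e0.
have lt := partition_mesh hxi jM.
have xj : xi j < (xi j + xi j.+1) / 2 < xi j.+1 by apply/andP; split; lra.
apply: (hreg tt jM xj).
by rewrite (dXhE hxi _ _ hX0 hX1 _ jM xj) e0 scaler0.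
Qed.

Lemma edge_vecE j t : evec j t =
  ((t1 * (X0 (xi j.+1) - X0 (xi j)).1 - t0 * (X1 (xi j.+1) - X1 (xi j)).1) / tau +
     (W (xi j.+1) - W (xi j)).1 / tau * t,
   (t1 * (X0 (xi j.+1) - X0 (xi j)).2 - t0 * (X1 (xi j.+1) - X1 (xi j)).2) / tau +
     (W (xi j.+1) - W (xi j)).2 / tau * t).
Proof.
rewrite [LHS]surjective_pairing /edge_vec !coordE.
by congr (_, _); ring.
Qed.

Lemma edge_vec_cvg j t : (evec j s).1 @[s --> t] --> (evec j t).1 /\
  (evec j s).2 @[s --> t] --> (evec j t).2.
Proof.
have aff (a b : R) : a + b * s @[s --> t] --> a + b * t.
  by apply: cvgD; [exact: cvg_cst|apply: cvgM; first exact: cvg_cst].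
split.
  by rewrite (funext (fun s => congr1 fst (edge_vecE j s))) edge_vecE; exact: aff.
by rewrite (funext (fun s => congr1 snd (edge_vecE j s))) edge_vecE; exact: aff.
Qed.

Lemma tangent_continuous j : (j < M)%N ->
  {within `[t0, t1], continuous (fun t => (tangent j t).1)} /\
  {within `[t0, t1], continuous (fun t => (tangent j t).2)}.
Proof.
move=> jM.
have cinv t : t0 <= t <= t1 -> (enorm (evec j s))^-1 @[s --> t] --> (enorm (evec j t))^-1.
  move=> tt; have [c1 c2] := edge_vec_cvg j t.
  apply: cvgV; first by rewrite gt_eqF // enorm_gt0 // edge_vec_neq0.
  have r : dot (evec j s) (evec j s) @[s --> t] --> dot (evec j t) (evec j t).
    by apply: cvgD; apply: cvgM.
  exact: (cvg_comp _ _ r (@sqrt_continuous R _)).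
by split; apply: continuous_in_subspaceT => t; rewrite inE /= in_itv /= => tt;
  have [c1 c2] := edge_vec_cvg j t; apply: cvgM => //; exact: cinv.
Qed.

(** The integrand is the time derivative of [tau * enorm (evec j t)]; the norm
    is differentiable because the edge does not degenerate. *)
Lemma length_derivative j : (j < M)%N ->
  integral t0 t1 (fun t => dot (W (xi j.+1) - W (xi j)) (tangent j t)) =
  tau * (enorm (X1 (xi j.+1) - X1 (xi j)) - enorm (X0 (xi j.+1) - X0 (xi j))).
Proof.
move=> jM; have [T1 T2] := tangent_continuous jM.
have lt := tnode_lt tau0 n0.
pose F t := tau * enorm (evec j t).
set w := W (xi j.+1) - W (xi j).
have dF (t : R) : t0 <= t <= t1 -> is_derive t (1 : R) F (dot w (tangent j t)).
  move=> tt; have e0 := edge_vec_neq0 jM tt.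
  pose a1 := (t1 * (X0 (xi j.+1) - X0 (xi j)).1 - t0 * (X1 (xi j.+1) - X1 (xi j)).1) / tau.
  pose a2 := (t1 * (X0 (xi j.+1) - X0 (xi j)).2 - t0 * (X1 (xi j.+1) - X1 (xi j)).2) / tau.
  have eE s : evec j s = (a1 + w.1 / tau * s, a2 + w.2 / tau * s) by exact: edge_vecE.
  pose r s := (a1 + w.1 / tau * s) ^+ 2 + (a2 + w.2 / tau * s) ^+ 2.
  have rE s : r s = dot (evec j s) (evec j s) by rewrite eE /r /dot /= !expr2.
  have FE : F = fun s => tau * Num.sqrt (r s).
    by apply/funext => s; rewrite /F /enorm -rE.
  have r0 : 0 < r t by rewrite rE dot_gt0.
  have dr : is_derive t (1 : R) r (2 * (w.1 / tau * (a1 + w.1 / tau * t) +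
      w.2 / tau * (a2 + w.2 / tau * t))).
    by rewrite /r; apply: is_derive_eq; rewrite /GRing.scale /=; ring.
  have ds := is_derive1_sqrt r0.
  have dsr := @is_derive1_comp _ _ r _ _ _ ds dr.
  rewrite FE.
  have -> : (fun s => tau * Num.sqrt (r s)) = tau *: (Num.sqrt \o r) by [].
  apply: is_derive_eq; rewrite /tangent /enorm -rE eE /dot !coordE /GRing.scale /=.
  have sr0 : Num.sqrt (r t) != 0 by rewrite gt_eqF // sqrtr_gt0.
  by field; rewrite sr0 gt_eqF.
have cw : {within `[t0, t1], continuous (fun t => dot w (tangent j t))}.
  move=> x; apply: cvgD; apply: cvgM; try exact: cvg_cst.
    exact: T1.
  exact: T2.
have F1 : F t1 - F t0 = tau * (enorm (X1 (xi j.+1) - X1 (xi j)) -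
    enorm (X0 (xi j.+1) - X0 (xi j))).
  by rewrite /F edge_vec_t0 // edge_vec_t1 // mulrBr.
rewrite -F1 /integral /Rintegral (continuous_FTC2 (F := F) lt cw) //.
  have cF t : t0 <= t <= t1 -> {for t, continuous F}.
    by move=> /dF ?; apply/differentiable_continuous/derivable1_diffP.
  split.
  - move=> x; rewrite in_itv /= => /andP[x0 x1].
    by have := dF x; rewrite !ltW // => /(_ isT) ?; exact: ex_derive.
  - by apply/cvg_at_right_filter/cF; rewrite lexx ltW.
  - by apply/cvg_at_left_filter/cF; rewrite lexx ltW.
move=> x; rewrite in_itv /= => /andP[x0 x1].
by have := dF x; rewrite !ltW // => /(_ isT) ?; rewrite derive1E; exact: derive_val.
Qed.

Lemma tangent_integrable j : (j < M)%N ->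
  mu.-integrable `[t0, t1] (EFin \o (fun t => (tangent j t).1)) /\
  mu.-integrable `[t0, t1] (EFin \o (fun t => (tangent j t).2)).
Proof.
move=> /tangent_continuous[T1 T2].
by split; (apply: continuous_compact_integrable; first exact: segment_compact).
Qed.

Definition mean_tangent j : R * R := vintegral t0 t1 (tangent j).

Lemma dot_mean_tangent j (w : R * R) : (j < M)%N ->
  dot w (mean_tangent j) = integral t0 t1 (fun t => dot w (tangent j t)).
Proof.
move=> jM; have [i1 i2] := tangent_integrable jM.
have [T1 T2] := tangent_continuous jM.
have iZ (c : R) (f : R -> R) : {within `[t0, t1], continuous f} ->
    mu.-integrable `[t0, t1] (EFin \o (fun t => c * f t)).
  move=> cf; apply: continuous_compact_integrable; first exact: segment_compact.
  by move=> t; apply: cvgM; [exact: cvg_cst|exact: cf].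
rewrite /dot /mean_tangent /vintegral /= /integral RintegralD ?RintegralZl //.
  exact: iZ.
exact: iZ.
Qed.

Lemma vintegral_jump j : (j < M)%N ->
  vintegral t0 t1 (fun t => jump (tauh tau n X0 X1 t) (xi j.+1)) =
  mean_tangent (cyc j.+1) - mean_tangent j.
Proof.
move=> jM.
have cM : (cyc j.+1 < M)%N.
  rewrite /cyc; case: eqVneq => [_|jM']; first exact: partition_size_gt0 hxi.
  by rewrite ltn_neqAle jM' jM.
have [i1 i2] := tangent_integrable jM; have [k1 k2] := tangent_integrable cM.
have -> : (fun t => jump (tauh tau n X0 X1 t) (xi j.+1)) =
    (fun t => tangent (cyc j.+1) t - tangent j t).
  by apply/funext => t; exact: jump_tauh.
rewrite [RHS]surjective_pairing /mean_tangent /vintegral !coordE.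
by congr (_, _); rewrite /integral -RintegralB.
Qed.

(** Summation by parts over the cyclic sequence of nodes. *)
Lemma jump_sum : \sum_(1 <= j < M.+1) dot (W (xi j))
    (vintegral t0 t1 (fun t => jump (tauh tau n X0 X1 t) (xi j))) =
  - \sum_(j < M) dot (W (xi j.+1) - W (xi j)) (mean_tangent j).
Proof.
rewrite big_add1 /= big_mkord.
pose H j := dot (W (xi j)) (mean_tangent (cyc j)).
have tel : \sum_(j < M) (H j.+1 - H j) = 0.
  rewrite -(big_mkord xpredT (fun j => H j.+1 - H j)) telescope_sumr //.
  rewrite /H /cyc eqxx; case: eqP => _; rewrite !closed_node // subrr //.
rewrite -[RHS]add0r -[X in _ = X + _]tel -sumrB; apply: eq_bigr => j _.
rewrite vintegral_jump ?ltn_ord // /H.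
have -> : cyc j = j by rewrite /cyc ltn_eqF.
by rewrite dotBr (dotBl (W (xi j.+1)) (W (xi j))); ring.
Qed.

Lemma perimeter_decreases : perimeter X1 <= perimeter X0.
Proof.
have [_ _ eq3] := hsol; have := dissipation; rewrite (eq3 _ vVh_sub) jump_sum.
pose l0 j := enorm (X0 (xi j.+1) - X0 (xi j)).
pose l1 j := enorm (X1 (xi j.+1) - X1 (xi j)).
have -> : \sum_(j < M) dot (W (xi j.+1) - W (xi j)) (mean_tangent j) =
    tau * (\sum_(j < M) l1 j - \sum_(j < M) l0 j).
  rewrite -sumrB mulr_sumr; apply: eq_bigr => j _.
  exact: etrans (dot_mean_tangent _ (ltn_ord j)) (length_derivative (ltn_ord j)).
rewrite (perimeterE hxi hX0) (perimeterE hxi hX1).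
by rewrite oppr_ge0 pmulr_rle0 // subr_le0.
Qed.

End perimeter.

Theorem theorem1 (R : realType) (M : nat) (xi : nat -> R)
    (hxi : partition01 M xi)
    (T : R) (N n : nat) (tau : R)
    (hT : 0 < T) (hn : (1 <= n <= N)%N) (htau : tau = T / N%:R)
    (X0 X1 : R -> R * R) (p q : R -> R)
    (hX0 : vVh M xi X0) (hX1 : vVh M xi X1) (hp : Vh M xi p) (hq : Vh M xi q)
    (hsimple0 : simple_closed X0) (hsimple1 : simple_closed X1)
    (hccw0 : counterclockwise M xi X0) (hccw1 : counterclockwise M xi X1)
    (hreg : forall t j x, tnode tau n.-1 <= t <= tnode tau n -> (j < M)%N ->
       xi j < x < xi j.+1 -> dXh tau n X0 X1 t x <> 0)
    (hsol : scheme_solution M xi tau n X0 X1 p q) :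
  area X1 = area X0 /\ perimeter X1 <= perimeter X0.
Proof.
have /andP[n0 nN] := hn.
have tau0 : 0 < tau by rewrite htau divr_gt0 // ltr0n (leq_trans n0).
split; last exact: (perimeter_decreases hxi tau0 n0 hX0 hX1 hp hq hreg hsol).
rewrite (area_shoelace hxi hX1 hsimple1 hccw1) (area_shoelace hxi hX0 hsimple0 hccw0).
by rewrite (shoelace_conserved hxi tau0 n0 hX0 hX1 hsol).
Qed.
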